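(* Let $\lambda$ be a partition of $n$. Then, as vector spaces, $$S^\lambda=\bigoplus_{\mu:\ \lambda/\mu\text{ is a horizontal strip}}\mathcal L^{\lambda/\mu}\big(\ker \mathrm{R2R}^\mu\big).$$ Furthermore, for every $\varepsilon$, the $\varepsilon$-eigenspace of $\mathrm{R2R}_n$ acting on $S^\lambda$ is $$\bigoplus_{\substack{\mu:\ \lambda/\mu\text{ is a horizontal strip},\\ \operatorname{eig}(\lambda/\mu)=\varepsilon}}\mathcal L^{\lambda/\mu}\big(\ker\mathrm{R2R}^\mu\big).$$ Moreover, if for each such $\mu$, $\mathcal K_\mu$ is a basis of $\ker\mathrm{R2R}^\mu$, then $\bigcup_{\mu:\ \lambda/\mu\text{ horizontal strip}}\mathcal L^{\lambda/\mu}(\mathcal K_\mu)$ is an eigenbasis for the action of $\mathrm{R2R}_n$ on $S^\lambda$.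
   Context: Words are finite sequences over the ordered alphabet $\{1,2,\dots,N\}$ ($N$ large enough). For a sequence $\alpha$ of nonnegative integers, $M^\alpha$ is the complex space with basis the words of evaluation $\alpha$ (with $\alpha_k$ occurrences of letter $k$), with the inner product making words orthonormal; $M^{(m)}$ is the span of all words of length $m$. For a letter $a$ and word $w=w_1\cdots w_m$: $\operatorname{sh}_a(w)=\sum_{j=0}^{m} w_1\cdots w_j\,a\,w_{j+1}\cdots w_m$, $\partial_a(w)=\sum_{k:w_k=a}w_1\cdots w_{k-1}w_{k+1}\cdots w_m$, extended linearly; $\mathrm{R2R}_m=\sum_a\operatorname{sh}_a\circ\partial_a$ on $M^{(m)}$. Specht module: for a tableau $t$ of shape $\lambda\vdash m$ filled bijectively with $1,\dots,m$, $\operatorname{word}(t)$ has $k$-th letter equal to the row index of $k$ in $t$; $\mathbf w_t=\sum_{\sigma\in\operatorname{ColStab}(t)}\operatorname{sign}(\sigma)\operatorname{word}(\sigma(t))$ (sum over permutations preserving the column sets of $t$, $\sigma(t)$ replacing entries $x$ by $\sigma(x)$); $S^\lambda=\operatorname{span}\{\mathbf w_t:t\text{ standard of shape }\lambda\}\subseteq M^\lambda$ (for $m=0$, $S^\emptyset$ is spanned by the empty word). $\mathrm{R2R}^\mu$ denotes the restriction of $\mathrm{R2R}_{|\mu|}$ to $S^\mu$. For a partition $\kappa=(\kappa_1,\dots,\kappa_l)$, $\kappa+\vec e_i$ adds $1$ to the $i$-th part ($\kappa_{l+1}=0$); when this is a partition, $\mathcal L^{\kappa}_i:S^\kappa\to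 S^{\kappa+\vec e_i}$ is $\operatorname{sh}_i|_{S^\kappa}$ followed by the orthogonal projection $M^{\kappa+\vec e_i}\to S^{\kappa+\vec e_i}$. For $\mu\subseteq\lambda$ with $\lambda$ obtained from $\mu$ by adding cells in rows $r_1\le r_2\le\dots\le r_k$ (with multiplicity), $\mathcal L^{\lambda/\mu}=\mathcal L_{r_k}\circ\cdots\circ\mathcal L_{r_1}$, where $\mathcal L_{r_j}$ means $\mathcal L^{\mu+\vec e_{r_1}+\dots+\vec e_{r_{j-1}}}_{r_j}$. A skew partition $\lambda/\mu$ is a horizontal strip if it has at most one cell in each column; $\operatorname{eig}(\lambda/\mu)=\binom{|\lambda|+1}{2}-\binom{|\mu|+1}{2}+\sum_{(i,j)\in\lambda/\mu}(j-i)$. *)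

(* Defs.v *)
From HB Require Import structures.
From mathcomp Require Import all_boot all_order all_fingroup all_algebra.

Set Implicit Arguments.
Unset Strict Implicit.
Unset Printing Implicit Defensive.

Import GRing.Theory Num.Theory.
Local Open Scope ring_scope.

(* Letters, rows and columns are all numbered from 0, so the alphabet
   {1, ..., N} is 'I_N and a cell in row i and column j still has content j - i.
   A vector is identified with its coordinates on the words of length m. *)
Notation wspace C N m := {ffun m.-tuple 'I_N -> C^o}.

Section Words.
Variables (C : numClosedFieldType) (N : nat).

(* The basis vector of the word s; it is 0 if s does not have length m.  Thanks
   to this convention the operators below have the intended value whenever
   their source and target degrees match, and no cast along an equality of
   degrees is ever needed. *)
Definition wvec m (s : seq 'I_N) : wspace C N m :=
  [ffun w : m.-tuple 'I_N => ((w : seq 'I_N) == s)%:R].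

Definition wext m m' (f : m.-tuple 'I_N -> wspace C N m') (x : wspace C N m) :
  wspace C N m' := \sum_(w : m.-tuple 'I_N) (x w : C) *: f w.

Fact wext_linear m m' (f : m.-tuple 'I_N -> wspace C N m') : linear (wext f).
Proof.
move=> a x y; rewrite /wext scaler_sumr -big_split /=.
by apply: eq_bigr => w _; rewrite !ffunE scalerDl scalerA.
Qed.
HB.instance Definition _ m m' (f : m.-tuple 'I_N -> wspace C N m') :=
  GRing.isLinear.Build C (wspace C N m) (wspace C N m') *:%R (wext f)
    (wext_linear f).

(* sh a : M^(m) -> M^(m'), to be used with m' = m + 1. *)
Definition sh (a : 'I_N) m m' : 'Hom(wspace C N m, wspace C N m') :=
  linfun (wext (fun w : m.-tuple 'I_N =>
    \sum_(j < m.+1) wvec m' (take j w ++ a :: drop j w))).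

(* del a : M^(m) -> M^(m'), to be used with m = m' + 1. *)
Definition del (a : 'I_N) m m' : 'Hom(wspace C N m, wspace C N m') :=
  linfun (wext (fun w : m.-tuple 'I_N =>
    \sum_(k < m | tnth w k == a) wvec m' (take k w ++ drop k.+1 w))).

(* For m = 0 this is 0, because del a is. *)
Definition R2R m : 'End(wspace C N m) :=
  \sum_(a < N) (sh a m.-1 m \o del a m m.-1)%VF.

(* The identity of M^(m) when m = m' (and 0 otherwise). *)
Definition wcast m m' : 'Hom(wspace C N m, wspace C N m') :=
  linfun (wext (fun w : m.-tuple 'I_N => wvec m' w)).

Definition wdot m (x y : wspace C N m) : C :=
  \sum_(w : m.-tuple 'I_N) (x w : C) * (y w : C)^*.

Fact wdot_bilinear m :
  bilinear_for (GRing.Scale.Law.clone _ _ *%R _)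
    (GRing.Scale.Law.clone _ _ (Num.conj \; *%R) _) (@wdot m).
Proof.
split=> [y|x] a u v; rewrite /wdot /= mulr_sumr -big_split /=;
  apply: eq_bigr => w _; rewrite !ffunE.
- by rewrite mulrDl mulrA.
- by rewrite rmorphD rmorphM mulrDr mulrCA.
Qed.
HB.instance Definition _ m :=
  bilinear_isBilinear.Build C _ _ _ _ _ (@wdot m) (wdot_bilinear m).

Fact wdot_hermitian m (x y : wspace C N m) :
  wdot x y = (-1) ^+ false * (wdot y x)^*.
Proof.
rewrite /wdot expr0 mul1r rmorph_sum; apply: eq_bigr => w _.
by rewrite rmorphM /= conjCK mulrC.
Qed.
HB.instance Definition _ m :=
  isHermitianSesquilinear.Build C (wspace C N m) false Num.conj (@wdot m)
    (@wdot_hermitian m).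

Fact wdot_gt0 m (x : wspace C N m) : x != 0 -> 0 < wdot x x.
Proof.
move=> nz_x; rewrite lt0r; apply/andP; split; last first.
  by apply: sumr_ge0 => w _; rewrite mul_conjC_ge0.
apply: contraNneq nz_x => /psumr_eq0P x0; apply/eqP/ffunP=> w; rewrite ffunE.
by apply/eqP; rewrite -mul_conjC_eq0 x0 // => u _; rewrite mul_conjC_ge0.
Qed.
HB.instance Definition _ m :=
  isDotProduct.Build C (wspace C N m) (@wdot m) (@wdot_gt0 m).

Definition orthoproj m (U : {vspace wspace C N m}) : 'End(wspace C N m) :=
  daddv_pi U (orthov (@wdot m) U).

End Words.

Section Shapes.
Variable N : nat.

(* A partition with at most N parts is the function giving its (possibly zero)
   parts, so trailing zeros are already quotiented out. *)
Definition rowshape := {ffun 'I_N -> nat}.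

Implicit Types lam mu : rowshape.

Definition psize lam : nat := (\sum_i lam i)%N.

Definition is_partition lam : bool :=
  [forall i : 'I_N, forall j : 'I_N, (i <= j)%N ==> (lam j <= lam i)%N].

Definition addcell lam (i : 'I_N) : rowshape := [ffun j => (lam j + (j == i))%N].

Definition cell lam := {i : 'I_N & 'I_(lam i)}.
Definition crow lam (c : cell lam) : 'I_N := tag c.
Definition ccol lam (c : cell lam) : nat := tagged c.

(* lam / mu is a horizontal strip.  Columns of index >= |lam| are empty. *)
Definition hstrip lam mu : bool :=
  [&& is_partition mu, [forall i, (mu i <= lam i)%N] &
      [forall j : 'I_(psize lam), #|[set i | mu i <= j < lam i]%N| <= 1]%N].

Definition eig lam mu : int :=
  'C((psize lam).+1, 2)%:Z - 'C((psize mu).+1, 2)%:Z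
  + \sum_(c : cell lam | (mu (crow c) <= ccol c)%N) ((ccol c)%:Z - (crow c)%:Z).

(* The row indices of the cells of lam / mu, in weakly increasing order. *)
Definition strip_rows lam mu : seq 'I_N :=
  flatten [seq nseq (lam i - mu i)%N i | i <- enum 'I_N].

(* The finite type of all mu contained in lam (not necessarily partitions). *)
Definition subshape lam := {dffun forall i : 'I_N, 'I_(lam i).+1}.
Definition subshape_val lam (mu : subshape lam) : rowshape :=
  [ffun i => (mu i : nat)].

(* A filling of lam is encoded by the function giving the position of each
   entry; it is bijective as soon as it is injective. *)
Definition tableau lam := {ffun 'I_(psize lam) -> cell lam}.

Definition is_tableau lam (t : tableau lam) : bool := injectiveb t.

Definition is_standard lam (t : tableau lam) : bool :=
  is_tableau t &&
  [forall k, forall l,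
    ((crow (t k) == crow (t l)) && (ccol (t k) < ccol (t l))%N
     || (ccol (t k) == ccol (t l)) && (crow (t k) < crow (t l))%N) ==> (k < l)%N].

(* The tableau s(t), with s(x) where t has x. *)
Definition tab_act lam (s : 'S_(psize lam)) (t : tableau lam) : tableau lam :=
  [ffun k => t ((s^-1)%g k)].

Definition colstab lam (t : tableau lam) : {set 'S_(psize lam)} :=
  [set s : 'S_(psize lam) | [forall k, ccol (t (s k)) == ccol (t k)]].

Definition word lam (t : tableau lam) : (psize lam).-tuple 'I_N :=
  [tuple crow (t k) | k < psize lam].

End Shapes.
Coercion subshape_val : subshape >-> rowshape.

Section SpechtModules.
Variables (C : numClosedFieldType) (N : nat).
Implicit Types lam mu kap : rowshape N.

Definition specht_vec lam (t : tableau lam) : wspace C N (psize lam) :=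
  \sum_(s in colstab t) (-1) ^+ s *: wvec C (psize lam) (word (tab_act s t)).

Definition Specht lam : {vspace wspace C N (psize lam)} :=
  <<[seq specht_vec t | t <- enum [pred t : tableau lam | is_standard t]]>>%VS.

(* The orthogonal projection from M^(|kap| + 1) onto S^(kap + e_i) extends the
   one from M^(kap + e_i), which contains the image of S^kap under sh i.  Only
   the restriction of this map to S^kap is meaningful. *)
Definition lift_op kap (i : 'I_N) :
    'Hom(wspace C N (psize kap), wspace C N (psize (addcell kap i))) :=
  (orthoproj (Specht (addcell kap i)) \o sh C i _ _)%VF.

(* Adds cells in the rows rs, read from left to right; m is the final degree. *)
Fixpoint lift_seq kap (rs : seq 'I_N) m :
    'Hom(wspace C N (psize kap), wspace C N m) :=
  if rs is r :: rs' then (lift_seq (addcell kap r) rs' m \o lift_op kap r)%VF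
  else wcast C N (psize kap) m.

Definition lift_skew lam mu :
    'Hom(wspace C N (psize mu), wspace C N (psize lam)) :=
  lift_seq mu (strip_rows lam mu) (psize lam).

Definition kerR2R mu : {vspace wspace C N (psize mu)} :=
  (Specht mu :&: lker (R2R C N (psize mu)))%VS.

Definition eigenR2R lam (e : C) : {vspace wspace C N (psize lam)} :=
  (Specht lam :&: passmx.leigenspace (R2R C N (psize lam)) e)%VS.

Definition is_eigenbasis lam (X : seq (wspace C N (psize lam))) : Prop :=
  basis_of (Specht lam) X /\
  {in X, forall v, v != 0 /\ exists e : C, R2R C N (psize lam) v = e *: v}.

End SpechtModules.

(* Main.v *)
Require Import Defs.
From HB Require Import structures.
From mathcomp Require Import all_boot all_order all_fingroup all_algebra.
From mathcomp Require Import ring zify.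
From mathcomp Require Import boolp functions.
From mathcomp Require Import reals complex.

(* Let E_ab replace one letter b by a, in all possible ways.  The relation
   [del_b, sh_a] = E_ab + (a == b) * (degree + 1) makes the span of all words a
   unitary module over u(N,1), in which Specht lam is the space of gl_N-highest
   weight vectors of weight lam.
   - For x in Specht mu, the lift of x is the orthogonal projection of sh_t x,
     t being the word of the rows of lam / mu: the part of sh_r x removed by a
     projection is a sum of images of lowering operators on rows <= r, which
     commute with the later sh_s.  The eigenvalue is read off commutators.
   - If h in Specht lam is not 0, deleting the largest possible letter keeps it a
     highest weight vector; iterating, one reaches some x in ker R2R with
     <sh_t x, h> != 0.  Hence the lifts of the kernels span.
   - If mu_a < lam_b for some a < b, then sl_2-theory for the rows a and b makes
     the lift vanish, because E_ba^(mu_a - mu_b + 1) x = 0.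
   - The kernels for different mu generate orthogonal u(N,1)-modules, so the sum
     is direct.
   - Along a horizontal strip, x can also be lifted from the bottom row upwards.
     The squared norm of each step is computed with the Casimir operator of the
     tensor product of the natural module with the words of length m, and turns
     out to be positive. *)

Set Implicit Arguments.
Unset Strict Implicit.
Unset Printing Implicit Defensive.

Import Order.TTheory GRing.Theory Num.Theory.
Local Open Scope ring_scope.

(** * The operators on functions on words *)

Section WordFunctions.
Variables (C : numClosedFieldType) (N : nat).
Local Notation I := 'I_N.
Local Notation F := (seq 'I_N -> C^o).
Implicit Types (f g h : F) (s : seq I) (a b c d : I).

(** The hard point is that a lift along a horizontal strip does not vanish. In the squared norm of a
    step adding a cell in row b, only the contributions of the removable cells can be negative: the
    one of row k has the sign of the content of the new cell minus that of the removed cell, which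
    is positive for k >= b and negative for k < b. When cells are added from the bottom row upwards,
    the rows above b are still those of mu, and the module generated by x in ker R2R has no highest
    weight vector with fewer cells than mu in such a row, so the negative contributions are absent.
    The change of order is harmless: insertions commute, and a single nonzero highest weight vector
    of weight lam in the module generated by x forces the projection of sh_t x to be nonzero.

    The operators act on functions on words of all lengths at once. Splitting off the first letter
    then turns each commutation relation into a plain induction, with no cast between degrees. *)

Definition hd c f : F := fun s => f (c :: s).
(** Tensoring with the basis vector c, the adjoint of [hd c] by [dot_pre]. *)
Definition pre c f : F :=
  fun s => if s is d :: s' then (d == c)%:R * (f s' : C) else (0 : C).

(* [Emap a b] replaces one letter b by a, in all possible ways: vectors are given
   by their coordinates, so the recursion inspects the resulting letter a. *)
Fixpoint Emap a b f s : C^o :=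
  if s is c :: s' then (c == a)%:R * (f (b :: s') : C) + (Emap a b (hd c f) s' : C)
  else (0 : C).
(** On coordinates the picture is transposed: the recursion of [shf] removes an a from the resulting
    word, and that of [delf] inserts one. *)
Fixpoint shf a f s : C^o :=
  if s is c :: s' then (c == a)%:R * (f s' : C) + (shf a (hd c f) s' : C)
  else (0 : C).
Fixpoint delf a f s : C^o :=
  (f (a :: s) : C) + (if s is c :: s' then (delf a (hd c f) s' : C) else (0 : C)).
(** The scalar degree + 1 as an operator, so that [de_sh] can be stated for inhomogeneous functions;
    [deg1E] recovers the scalar. *)
Definition deg1 f : F := fun s => (size s).+1%:R * (f s : C).

Lemma wfP f g : (forall s, f s = g s) -> f = g.
Proof. by move=> e; apply/funext. Qed.

Lemma wfP_hd f g : f [::] = g [::] -> (forall c, hd c f = hd c g) -> f = g.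
Proof.
move=> e0 e1; apply: wfP => -[|c s]; first exact: e0.
by have := e1 c => /(congr1 (fun k => k s)).
Qed.

Lemma wf_add f g s : (f + g) s = (f s : C) + (g s : C). Proof. by []. Qed.
Lemma wf_opp f s : (- f) s = - (f s : C). Proof. by []. Qed.
Lemma wf_scale (k : C) f s : (k *: f) s = k * (f s : C). Proof. by []. Qed.
Lemma wf_zero s : (0 : F) s = (0 : C). Proof. by []. Qed.
Definition wfE := (wf_add, wf_opp, wf_scale, wf_zero).

Fact hd_linear c : linear (hd c : F -> F). Proof. by []. Qed.
HB.instance Definition _ c :=
  GRing.isLinear.Build C F F *:%R (hd c) (@hd_linear c).

Fact pre_linear c : linear (pre c : F -> F).
Proof.
move=> k f g; apply: wfP => -[|d s]; first by rewrite /= ?wfE /GRing.scale /=; ring.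
by rewrite /= ?wfE /GRing.scale /=; ring.
Qed.
HB.instance Definition _ c :=
  GRing.isLinear.Build C F F *:%R (pre c) (@pre_linear c).

Fact Emap_linear a b : linear (Emap a b : F -> F).
Proof.
move=> k f g; apply: wfP => s; rewrite ?wfE.
elim: s f g => [|c s IH] f g /=; first by rewrite /GRing.scale /=; ring.
have -> : hd c (k *: f + g) = k *: hd c f + hd c g by [].
by rewrite IH ?wfE /GRing.scale /=; ring.
Qed.
HB.instance Definition _ a b :=
  GRing.isLinear.Build C F F *:%R (Emap a b) (@Emap_linear a b).

Fact shf_linear a : linear (shf a : F -> F).
Proof.
move=> k f g; apply: wfP => s; rewrite ?wfE.
elim: s f g => [|c s IH] f g /=; first by rewrite /GRing.scale /=; ring.
have -> : hd c (k *: f + g) = k *: hd c f + hd c g by [].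
by rewrite IH ?wfE /GRing.scale /=; ring.
Qed.
HB.instance Definition _ a :=
  GRing.isLinear.Build C F F *:%R (shf a) (@shf_linear a).

Fact delf_linear a : linear (delf a : F -> F).
Proof.
move=> k f g; apply: wfP => s; rewrite ?wfE.
elim: s f g => [|c s IH] f g /=; first by rewrite !addr0 ?wfE.
have -> : hd c (k *: f + g) = k *: hd c f + hd c g by [].
by rewrite IH ?wfE /GRing.scale /=; ring.
Qed.
HB.instance Definition _ a :=
  GRing.isLinear.Build C F F *:%R (delf a) (@delf_linear a).

Lemma hdD c f g : hd c (f + g) = hd c f + hd c g.
Proof. exact: linearD. Qed.
Lemma hdN c f : hd c (- f) = - hd c f.
Proof. exact: linearN. Qed.
Lemma hdZ c (k : C) f : hd c (k *: f) = k *: hd c f.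
Proof. exact: linearZ. Qed.
Lemma hd0 c : hd c 0 = 0.
Proof. exact: linear0. Qed.
Lemma hd_sum c (J : Type) (r : seq J) (p : pred J) (G : J -> F) :
  hd c (\sum_(i <- r | p i) G i) = \sum_(i <- r | p i) hd c (G i).
Proof. exact: linear_sum. Qed.
Lemma preD c f g : pre c (f + g) = pre c f + pre c g.
Proof. exact: linearD. Qed.
Lemma preN c f : pre c (- f) = - pre c f.
Proof. exact: linearN. Qed.
Lemma preZ c (k : C) f : pre c (k *: f) = k *: pre c f.
Proof. exact: linearZ. Qed.
Lemma pre0 c : pre c 0 = 0.
Proof. exact: linear0. Qed.
Lemma pre_sum c (J : Type) (r : seq J) (p : pred J) (G : J -> F) :
  pre c (\sum_(i <- r | p i) G i) = \sum_(i <- r | p i) pre c (G i).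
Proof. exact: linear_sum. Qed.
Lemma EmapD a b f g : Emap a b (f + g) = Emap a b f + Emap a b g.
Proof. exact: linearD. Qed.
Lemma EmapN a b f : Emap a b (- f) = - Emap a b f.
Proof. exact: linearN. Qed.
Lemma EmapZ a b (k : C) f : Emap a b (k *: f) = k *: Emap a b f.
Proof. exact: linearZ. Qed.
Lemma Emap0 a b : Emap a b 0 = 0.
Proof. exact: linear0. Qed.
Lemma Emap_sum a b (J : Type) (r : seq J) (p : pred J) (G : J -> F) :
  Emap a b (\sum_(i <- r | p i) G i) = \sum_(i <- r | p i) Emap a b (G i).
Proof. exact: linear_sum. Qed.
Lemma shfD a f g : shf a (f + g) = shf a f + shf a g.
Proof. exact: linearD. Qed.
Lemma shfN a f : shf a (- f) = - shf a f.
Proof. exact: linearN. Qed.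
Lemma shfZ a (k : C) f : shf a (k *: f) = k *: shf a f.
Proof. exact: linearZ. Qed.
Lemma shf0 a : shf a 0 = 0.
Proof. exact: linear0. Qed.
Lemma shf_sum a (J : Type) (r : seq J) (p : pred J) (G : J -> F) :
  shf a (\sum_(i <- r | p i) G i) = \sum_(i <- r | p i) shf a (G i).
Proof. exact: linear_sum. Qed.
Lemma delfD a f g : delf a (f + g) = delf a f + delf a g.
Proof. exact: linearD. Qed.
Lemma delfN a f : delf a (- f) = - delf a f.
Proof. exact: linearN. Qed.
Lemma delfZ a (k : C) f : delf a (k *: f) = k *: delf a f.
Proof. exact: linearZ. Qed.
Lemma delf0 a : delf a 0 = 0.
Proof. exact: linear0. Qed.
Lemma delf_sum a (J : Type) (r : seq J) (p : pred J) (G : J -> F) :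
  delf a (\sum_(i <- r | p i) G i) = \sum_(i <- r | p i) delf a (G i).
Proof. exact: linear_sum. Qed.
Definition wlin := (hdD, hdN, hdZ, hd0, preD, preN, preZ, pre0, EmapD, EmapN, EmapZ, Emap0,
  shfD, shfN, shfZ, shf0, delfD, delfN, delfZ, delf0).

Lemma hd_E c a b f : hd c (Emap a b f) = (c == a)%:R *: hd b f + Emap a b (hd c f).
Proof. by []. Qed.
Lemma hd_sh c a f : hd c (shf a f) = (c == a)%:R *: f + shf a (hd c f).
Proof. by []. Qed.
Lemma hd_de c a f : hd c (delf a f) = hd c (hd a f) + delf a (hd c f).
Proof. by []. Qed.
Lemma hd_pre c d f : hd c (pre d f) = (c == d)%:R *: f.
Proof. by []. Qed.
Lemma hd_deg1 c f : hd c (deg1 f) = hd c f + deg1 (hd c f).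
Proof.
by apply: wfP => s; rewrite /hd /deg1 !wfE /= -natr1; ring.
Qed.
Lemma E_nil a b f : Emap a b f [::] = (0 : C). Proof. by []. Qed.
Lemma sh_nil a f : shf a f [::] = (0 : C). Proof. by []. Qed.
Lemma de_nil a f : delf a f [::] = (f [:: a] : C). Proof. exact: addr0. Qed.
Lemma pre_nil a f : pre a f [::] = (0 : C). Proof. by []. Qed.
Lemma hd_app c f s : f (c :: s) = hd c f s. Proof. by []. Qed.
#[local] Arguments Emap : simpl never.
#[local] Arguments shf : simpl never.
#[local] Arguments delf : simpl never.
#[local] Arguments hd : simpl never.
Local Definition wnil := (E_nil, sh_nil, de_nil, pre_nil).
Local Definition whd := (hd_E, hd_sh, hd_de, hd_pre, hd_deg1, wlin).

(** Words of length m span the m-th tensor power of the natural module of gl_N; these are the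
    relations of the matrix units. *)
Lemma E_comm a b c d f : Emap a b (Emap c d f) =
  Emap c d (Emap a b f) + (b == c)%:R *: Emap a d f - (a == d)%:R *: Emap c b f.
Proof.
apply: wfP => s; elim: s f => [|e s IH] f; first by rewrite !wfE !wnil; ring.
rewrite !hd_app !whd !wfE IH !wfE.
by rewrite ?[d == a]eq_sym ?[c == b]eq_sym; ring.
Qed.

Lemma E_sh a b c f : Emap a b (shf c f) = shf c (Emap a b f) + (b == c)%:R *: shf a f.
Proof.
apply: wfP => s; elim: s f => [|e s IH] f; first by rewrite !wfE !wnil; ring.
rewrite !hd_app !whd !wfE IH !wfE.
by ring.
Qed.

Lemma E_de a b c f : Emap a b (delf c f) = delf c (Emap a b f) - (a == c)%:R *: delf b f.
Proof.
apply: wfP => s; elim: s f => [|e s IH] f.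
  by rewrite !wfE !wnil !hd_app !whd !wfE wnil [c == a]eq_sym /hd; ring.
rewrite !hd_app !whd !wfE IH !wfE.
by rewrite ?[c == a]eq_sym; ring.
Qed.

(** Deleting an old b merges the two slots beside it, so that inserting first has one more
    possibility: a in the place of b. Deleting the inserted letter itself gives the word back, once
    for each of the degree + 1 slots. *)
Lemma de_sh a b f : delf b (shf a f) = shf a (delf b f) + Emap a b f + (a == b)%:R *: deg1 f.
Proof.
apply: wfP => s; elim: s f => [|e s IH] f.
  by rewrite !wfE !wnil !hd_app !whd !wfE wnil eq_sym /deg1 /=; ring.
rewrite !hd_app !whd !wfE IH !wfE.
by rewrite ?[b == a]eq_sym; ring.
Qed.

Lemma sh_sh a b f : shf a (shf b f) = shf b (shf a f).
Proof.
apply: wfP => s; elim: s f => [//|e s IH] f.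
by rewrite !hd_app !whd !wfE IH; ring.
Qed.

Lemma E_pre a b c f : Emap a b (pre c f) = (b == c)%:R *: pre a f + pre c (Emap a b f).
Proof.
apply: wfP_hd => [|e]; first by rewrite !wfE !wnil; ring.
by rewrite !whd; apply: wfP => s; rewrite !wfE; ring.
Qed.

(** This and the next two lemmas are needed because [cf] reverses words: operators acting at all
    positions do not see the direction of reading. *)
Lemma rev_E a b f s : Emap a b f (rev s) = Emap a b (fun u => f (rev u)) s.
Proof.
have rconsE : forall u c f, Emap a b f (rcons u c) =
    (c == a)%:R * (f (rcons u b) : C) + (Emap a b (fun v => f (rcons v c)) u : C).
  elim=> [|e u IH] c g; rewrite ?rcons_cons !hd_app !whd !wfE ?IH //.
  by rewrite /hd /=; ring.
elim: s f => [//|c s IH] f; rewrite rev_cons rconsE !hd_app !whd !wfE IH /hd -rev_cons.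
by congr (_ + Emap _ _ _ _); apply: wfP => u; rewrite /hd rev_cons.
Qed.

Lemma rev_sh a f s : shf a f (rev s) = shf a (fun u => f (rev u)) s.
Proof.
have rconsE : forall u c f, shf a f (rcons u c) =
    (c == a)%:R * (f u : C) + (shf a (fun v => f (rcons v c)) u : C).
  elim=> [|e u IH] c g; rewrite ?rcons_cons !hd_app !whd !wfE ?IH //.
  by rewrite /hd /=; ring.
elim: s f => [//|c s IH] f; rewrite rev_cons rconsE !hd_app !whd !wfE IH /hd.
by congr (_ + shf _ _ _); apply: wfP => u; rewrite /hd rev_cons.
Qed.

Lemma rev_de a f s : delf a f (rev s) = delf a (fun u => f (rev u)) s.
Proof.
have rconsE : forall u c f, delf a f (rcons u c) =
    (f (rcons (rcons u c) a) : C) + (delf a (fun v => f (rcons v c)) u : C).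
  elim=> [|e u IH] c g; rewrite ?rcons_cons !hd_app !whd !wfE ?wnil ?IH /hd /=; ring.
elim: s f => [|c s IH] f; first by rewrite !wnil.
rewrite rev_cons rconsE !hd_app !whd !wfE IH /hd !rev_cons.
by congr (_ + delf _ _ _); apply: wfP => u; rewrite /hd rev_cons.
Qed.

End WordFunctions.
#[global] Arguments Emap : simpl never.
#[global] Arguments shf : simpl never.
#[global] Arguments delf : simpl never.
#[global] Arguments hd : simpl never.
#[global] Arguments pre : simpl never.

(** * Inner product and weights *)

Section DotProduct.
Variables (C : numClosedFieldType) (N : nat).
Local Notation I := 'I_N.
Local Notation F := (seq 'I_N -> C^o).
Implicit Types (f g h : F) (s : seq I) (a b c d : I) (m : nat).

(** Only the coordinates on words of length m count, hence the condition [deg m] wherever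
    definiteness is used. *)
Fixpoint dot m f g : C :=
  if m is m'.+1 then \sum_c dot m' (hd c f) (hd c g)
  else (f [::] : C) * (g [::] : C)^*.

Lemma dotS m f g : dot m.+1 f g = \sum_c dot m (hd c f) (hd c g).
Proof. by []. Qed.
Lemma dot_nil f g : dot 0 f g = (f [::] : C) * (g [::] : C)^*.
Proof. by []. Qed.
#[local] Arguments dot : simpl never.

Definition deg m f := forall s, size s != m -> f s = 0.

Lemma dot_eq m f f' g g' : (forall s, size s = m -> f s = f' s) ->
  (forall s, size s = m -> g s = g' s) -> dot m f g = dot m f' g'.
Proof.
elim: m f f' g g' => [|m IH] f f' g g' ef eg; rewrite ?dotS ?dot_nil; first by rewrite ef // eg.
by apply: eq_bigr => c _; apply: IH => s es; rewrite /hd ?ef ?eg //= es.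
Qed.

Lemma dotDl m f g h : dot m (f + g) h = dot m f h + dot m g h.
Proof.
elim: m f g h => [|m IH] f g h; rewrite ?dotS ?dot_nil; first by rewrite !wfE mulrDl.
by rewrite -big_split; apply: eq_bigr => c _; rewrite hdD IH.
Qed.

Lemma dotZl m (k : C) f h : dot m (k *: f) h = k * dot m f h.
Proof.
elim: m f h => [|m IH] f h; rewrite ?dotS ?dot_nil; first by rewrite !wfE mulrA.
by rewrite mulr_sumr; apply: eq_bigr => c _; rewrite hdZ IH.
Qed.

Lemma dotC m f g : dot m g f = (dot m f g)^*.
Proof.
elim: m f g => [|m IH] f g; rewrite ?dotS ?dot_nil; first by rewrite rmorphM /= conjCK mulrC.
by rewrite rmorph_sum; apply: eq_bigr => c _; rewrite IH.
Qed.

Lemma dotDr m f g h : dot m h (f + g) = dot m h f + dot m h g.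
Proof. by rewrite dotC dotDl rmorphD /= -!(dotC _ _ h). Qed.
Lemma dotZr m (k : C) f h : dot m h (k *: f) = k^* * dot m h f.
Proof. by rewrite dotC dotZl rmorphM /= -(dotC _ _ h). Qed.
Lemma dotNl m f h : dot m (- f) h = - dot m f h.
Proof. by rewrite -scaleN1r dotZl mulN1r. Qed.
Lemma dotNr m f h : dot m h (- f) = - dot m h f.
Proof. by rewrite dotC dotNl rmorphN /= -(dotC _ _ h). Qed.
Lemma dot0l m h : dot m 0 h = 0.
Proof. by rewrite -(scale0r (0 : F)) dotZl mul0r. Qed.
Lemma dot0r m h : dot m h 0 = 0.
Proof. by rewrite dotC dot0l rmorph0. Qed.
Definition dotE := (dotDl, dotDr, dotNl, dotNr, dotZl, dotZr, dot0l, dot0r).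

Lemma dot_suml m (J : Type) (r : seq J) (p : pred J) (G : J -> F) h :
  dot m (\sum_(i <- r | p i) G i) h = \sum_(i <- r | p i) dot m (G i) h.
Proof. by elim/big_rec2: _ => [|i x y _ <-]; rewrite !dotE. Qed.
Lemma dot_sumr m (J : Type) (r : seq J) (p : pred J) (G : J -> F) h :
  dot m h (\sum_(i <- r | p i) G i) = \sum_(i <- r | p i) dot m h (G i).
Proof. by elim/big_rec2: _ => [|i x y _ <-]; rewrite !dotE. Qed.

Lemma dot_eq0C m f g : dot m f g = 0 -> dot m g f = 0.
Proof. by move=> fg; rewrite dotC fg rmorph0. Qed.

Lemma dot_ge0 m f : 0 <= dot m f f.
Proof.
by elim: m f => [|m IH] f; rewrite ?dotS ?dot_nil; [rewrite mul_conjC_ge0 | apply: sumr_ge0 => c _].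
Qed.

Lemma dot_eq0 m f : deg m f -> dot m f f = 0 -> f = 0.
Proof.
move=> df d0; apply: wfP => s; have [es|/df //] := eqVneq (size s) m.
elim: m f s d0 {df} es => [|m IH] f [|c s] //=; rewrite ?dotS ?dot_nil => d0.
  by move=> _; apply/eqP; rewrite -mul_conjC_eq0 d0.
case=> es; apply: (IH (hd c f)) => //.
by apply: (psumr_eq0P _ d0) => // i _; apply: dot_ge0.
Qed.

Lemma dot_gt0 m f : deg m f -> f != 0 -> 0 < dot m f f.
Proof.
by move=> df f0; rewrite lt0r dot_ge0 andbT; apply: contraNneq f0 => /(dot_eq0 df) ->.
Qed.

Lemma dot_Emap a b m f g : dot m (Emap a b f) g = dot m f (Emap b a g).
Proof.
elim: m f g => [|m IH] f g; rewrite ?dotS ?dot_nil; first by rewrite !E_nil mul0r conjC0 mulr0.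
rewrite (eq_bigr (fun c => (c == a)%:R * dot m (hd b f) (hd c g) +
  dot m (hd c f) (Emap b a (hd c g)))); last by move=> c _; rewrite hd_E !dotE IH.
rewrite [RHS](eq_bigr (fun c => (c == b)%:R * dot m (hd c f) (hd a g) +
  dot m (hd c f) (Emap b a (hd c g)))); last first.
  by move=> c _; rewrite hd_E !dotE conjC_nat.
rewrite !big_split; congr (_ + _).
rewrite [LHS](bigD1 a) // [RHS](bigD1 b) //= !eqxx !big1 ?addr0 // => i /negPf ->;
  by rewrite mul0r.
Qed.

Lemma dot_sh a m f g : dot m.+1 (shf a f) g = dot m f (delf a g).
Proof.
elim: m f g => [|m IH] f g.
  rewrite dotS (bigD1 a) //= big1 => [|c /negPf ca]; last first.
    by rewrite hd_sh dot_nil !wfE sh_nil ca mul0r !add0r mul0r.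
  by rewrite hd_sh !dot_nil !wfE sh_nil de_nil eqxx mul1r !addr0.
have -> : dot m.+1 f (delf a g) =
    \sum_c (dot m (hd c f) (hd c (hd a g)) + dot m (hd c f) (delf a (hd c g))).
  by rewrite dotS; apply: eq_bigr => c _; rewrite hd_de dotDr.
have -> : dot m.+2 (shf a f) g =
    \sum_c ((c == a)%:R * dot m.+1 f (hd c g) + dot m (hd c f) (delf a (hd c g))).
  by rewrite dotS; apply: eq_bigr => c _; rewrite hd_sh dotDl dotZl IH.
rewrite !big_split; congr (_ + _).
by rewrite [LHS](bigD1 a) //= !eqxx mul1r big1 ?addr0 // => i /negPf ->; rewrite mul0r.
Qed.

Lemma dot_de a m f g : dot m (delf a f) g = dot m.+1 f (shf a g).
Proof. by rewrite dotC -dot_sh -dotC. Qed.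

Lemma dot_pre c m f g : dot m.+1 (pre c f) g = dot m f (hd c g).
Proof.
rewrite dotS (bigD1 c) //= hd_pre eqxx scale1r big1 ?addr0 // => i /negPf ic.
by rewrite hd_pre ic scale0r dot0l.
Qed.

Lemma dot_hd c m f g : dot m (hd c f) g = dot m.+1 f (pre c g).
Proof. by rewrite dotC -dot_pre -dotC. Qed.

Lemma degD m f g : deg m f -> deg m g -> deg m (f + g).
Proof. by move=> df dg s sm; rewrite wfE df // dg // addr0. Qed.
Lemma degZ m (k : C) f : deg m f -> deg m (k *: f).
Proof. by move=> df s sm; rewrite wfE df // mulr0. Qed.
Lemma deg0 m : deg m 0. Proof. by []. Qed.

Lemma deg_hd m c f : deg m.+1 f -> deg m (hd c f).
Proof. by move=> df s sm; apply: df. Qed.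
Lemma Emap_local a b f s : (forall u, size u = size s -> f u = 0) -> Emap a b f s = 0.
Proof.
elim: s f => [//|c s IH] f f0; rewrite hd_app hd_E !wfE IH ?addr0.
  by rewrite /hd f0 ?mulr0.
by move=> u us; apply: f0; rewrite /= us.
Qed.
Lemma sh_local a f s : (forall u, (size u).+1 = size s -> f u = 0) -> shf a f s = 0.
Proof.
elim: s f => [//|c s IH] f f0; rewrite hd_app hd_sh !wfE IH ?addr0.
  by rewrite f0 ?mulr0.
by move=> u us; apply: f0; rewrite /= us.
Qed.
Lemma de_local a f s : (forall u, size u = (size s).+1 -> f u = 0) -> delf a f s = 0.
Proof.
elim: s f => [|c s IH] f f0; first by rewrite de_nil f0.
rewrite hd_app hd_de !wfE IH ?addr0; first by rewrite /hd f0.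
by move=> u us; apply: f0; rewrite /= us.
Qed.
Lemma deg_Emap m a b f : deg m f -> deg m (Emap a b f).
Proof. by move=> df s sm; apply: Emap_local => u us; rewrite df ?us. Qed.
Lemma deg_sh m a f : deg m f -> deg m.+1 (shf a f).
Proof. by move=> df s sm; apply: sh_local => u us; rewrite df // -eqSS us. Qed.
Lemma deg_de m a f : deg m.+1 f -> deg m (delf a f).
Proof. by move=> df s sm; apply: de_local => u us; rewrite df // us. Qed.
Lemma deg_de0 a f : deg 0 f -> delf a f = 0.
Proof. by move=> df; apply: wfP => s; apply: de_local => u us; rewrite df // us. Qed.
Lemma deg1E m f : deg m f -> deg1 f = m.+1%:R *: f.
Proof.
move=> df; apply: wfP => s; rewrite /deg1 wfE.
by have [->//|sm] := eqVneq (size s) m; rewrite df // !mulr0.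
Qed.
Lemma deg_sum m (J : Type) (r : seq J) (p : pred J) (G : J -> F) :
  (forall i, p i -> deg m (G i)) -> deg m (\sum_(i <- r | p i) G i).
Proof. by move=> dG; elim/big_rec: _ => // i x pi dx; apply: degD => //; apply: dG. Qed.
Lemma degN m f : deg m f -> deg m (- f).
Proof. by rewrite -scaleN1r; apply: degZ. Qed.

End DotProduct.

(** * Weights and highest weight vectors of gl_N *)

Section Weights.
Variables (C : numClosedFieldType) (N : nat).
Local Notation I := 'I_N.
Local Notation F := (seq 'I_N -> C^o).
Implicit Types (f g h x : F) (s t : seq I) (a b c d : I) (m : nat) (lam mu : rowshape N).

Definition cont s : rowshape N := [ffun i => count_mem i s].
Definition wt lam f := forall a, Emap a a f = (lam a)%:R *: f.
Definition hwv lam f := wt lam f /\ forall a b, (a < b)%N -> Emap a b f = 0.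

Lemma Emap_diag a f s : Emap a a f s = (count_mem a s)%:R * (f s : C).
Proof.
elim: s f => [|c s IH] f; first by rewrite E_nil mul0r.
rewrite hd_app hd_E !wfE IH /= natrD mulrDl; congr (_ + _).
by have [->//|_] := eqVneq c a; rewrite !mul0r.
Qed.

Lemma wtP lam f : wt lam f <-> forall s, f s != 0 -> cont s = lam.
Proof.
split=> [wf s fs|wf a].
  apply/ffunP => a; rewrite ffunE; apply/eqP.
  have /(congr1 (fun k : F => k s)) := wf a; rewrite Emap_diag !wfE.
  by move/(mulIf fs)/eqP; rewrite eqr_nat.
apply: wfP => s; rewrite Emap_diag !wfE; have [->|fs] := eqVneq (f s) 0.
  by rewrite !mulr0.
by rewrite -(wf s fs) ffunE.
Qed.

Lemma psize_cont s : psize (cont s) = size s.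
Proof.
rewrite /psize; elim: s => [|c s IH] /=.
  by rewrite big1 // => i _; rewrite ffunE.
rewrite -IH -add1n; under eq_bigr => i _ do rewrite ffunE /=.
rewrite big_split /= (bigD1 c) //= eqxx big1 ?addn0 => [|i /negPf ic].
  by congr addn; apply: eq_bigr => i _; rewrite ffunE.
by rewrite eq_sym ic.
Qed.

Lemma wt_deg lam f : wt lam f -> deg (psize lam) f.
Proof.
move=> /wtP wf s sm; apply/eqP/contraT => /wf e.
by move: sm; rewrite -e psize_cont eqxx.
Qed.

Lemma wt_orth m lam mu f g : wt lam f -> wt mu g -> lam <> mu -> dot m f g = 0.
Proof.
move=> wf wg lm; have [a lma] : exists a, lam a != mu a.
  apply/existsP; apply: contraT; rewrite negb_exists => /forallP e.
  by case: lm; apply/ffunP => a; apply/eqP; rewrite -[_ == _]negbK.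
have := dot_Emap a a m f g; rewrite wf wg dotZl dotZr conjC_nat => /eqP.
rewrite -subr_eq0 -mulrBl mulf_eq0 subr_eq0 eqr_nat (negPf lma) /=.
by move=> /eqP.
Qed.

Lemma psize_addcell lam a : psize (addcell lam a) = (psize lam).+1.
Proof.
rewrite /psize; under eq_bigr => i _ do rewrite ffunE.
rewrite big_split /= -addn1; congr addn.
by rewrite (bigD1 a) //= eqxx big1 // => i /negPf ->.
Qed.

Lemma wt_sh lam a f : wt lam f -> wt (addcell lam a) (shf a f).
Proof.
move=> wf b; rewrite E_sh wf shfZ ffunE natrD scalerDl; congr (_ + _).
by have [->//|_] := eqVneq b a; rewrite !scale0r.
Qed.
Lemma wt_de lam a f : wt (addcell lam a) f -> wt lam (delf a f).
Proof.
move=> wf b; rewrite E_de wf delfZ ffunE natrD scalerDl -addrA; apply/eqP.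
by have [->|_] := eqVneq b a; rewrite ?subrr ?addr0 ?scale0r ?subr0 ?addr0.
Qed.
Lemma wt_hd lam a f : wt (addcell lam a) f -> wt lam (hd a f).
Proof.
move=> wf b; have := congr1 (hd a) (wf b).
rewrite hd_E hdZ ffunE natrD scalerDl [b == a]eq_sym.
have [->|_] := eqVneq a b; last by rewrite !scale0r add0r addr0.
by rewrite scale1r addrC => /addIr.
Qed.

Lemma wt_linear lam k f g : wt lam f -> wt lam g -> wt lam (k *: f + g).
Proof.
by move=> wf wg a; rewrite EmapD EmapZ wf wg scalerDr !scalerA mulrC.
Qed.
Lemma wt0 lam : wt lam 0.
Proof. by move=> a; rewrite Emap0 scaler0. Qed.
Lemma hwv_linear lam k f g : hwv lam f -> hwv lam g -> hwv lam (k *: f + g).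
Proof.
move=> [wf hf] [wg hg]; split; first exact: wt_linear.
by move=> a b ab; rewrite EmapD EmapZ hf // hg // scaler0 addr0.
Qed.
Lemma hwv0 lam : hwv lam 0.
Proof. by split=> [|a b _]; [apply: wt0 | rewrite Emap0]. Qed.
Lemma hwvD lam f g : hwv lam f -> hwv lam g -> hwv lam (f + g).
Proof. by rewrite -[f]scale1r => hf hg; apply: hwv_linear; rewrite ?scale1r // scale1r in hf *. Qed.
Lemma hwvZ lam k f : hwv lam f -> hwv lam (k *: f).
Proof. by move=> hf; rewrite -[_ *: _]addr0; apply: hwv_linear => //; apply: hwv0. Qed.
Lemma hwvB lam f g : hwv lam f -> hwv lam g -> hwv lam (f - g).
Proof. by move=> hf hg; rewrite -scaleN1r; apply: hwvD => //; apply: hwvZ. Qed.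
Lemma hwv_sum lam (J : Type) (r : seq J) (p : pred J) (G : J -> F) :
  (forall i, p i -> hwv lam (G i)) -> hwv lam (\sum_(i <- r | p i) G i).
Proof.
by move=> dG; elim/big_rec: _ => [|i x pi dx]; [apply: hwv0 | apply: hwvD => //; apply: dG].
Qed.
Lemma hwv_deg lam f : hwv lam f -> deg (psize lam) f.
Proof. by case=> /wt_deg. Qed.
Lemma hwv_dot_lower lam a b f h : (a < b)%N -> hwv lam h -> forall m, dot m (Emap b a f) h = 0.
Proof. by move=> ab [_ hh] m; rewrite dot_Emap hh // dot0r. Qed.

(* A lowering operator multiplies the squared norm of a highest weight vector by
   lam_a - lam_b, which therefore cannot be negative. *)
Lemma hwv_partition lam f : hwv lam f -> f <> 0 -> is_partition lam.
Proof.
move=> hf f0; apply/forallP => a; apply/forallP => b; apply/implyP => ab.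
rewrite leqNgt; apply/negP => lab; case: f0.
have {}ab : (a < b)%N by rewrite ltn_neqAle ab andbT; apply: contraTneq lab => /val_inj ->; rewrite ltnn.
have [wf rf] := hf; apply: (dot_eq0 (hwv_deg hf)); set m := psize lam.
have := dot_ge0 m (Emap b a f); rewrite dot_Emap E_comm rf // Emap0 add0r !eqxx !scale1r.
rewrite !wf -scalerBl dotZr rmorphB /= !conjC_nat => ge0.
apply/eqP; rewrite eq_le dot_ge0 andbT -oppr_ge0 -mulN1r.
have p : (lam b)%:R - (lam a)%:R > 0 :> C by rewrite subr_gt0 ltr_nat.
rewrite -(pmulr_rge0 _ p) mulN1r mulrN -mulNr opprB.
exact: ge0.
Qed.

End Weights.
#[global] Arguments dot : simpl never.

(** * Projection onto highest weight vectors *)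

(** A subspace of maximal dimension inside Q is all of Q, since a missing vector could be added to
    it. Spaces given by equations or by generators thus become vector spaces in the sense of the
    library. *)
Lemma vspace_of_pred (K : fieldType) (vT : vectType K) (Q : vT -> Prop) :
  Q 0 -> (forall k x y, Q x -> Q y -> Q (k *: x + y)) ->
  exists W : {vspace vT}, forall x, x \in W <-> Q x.
Proof.
move=> Q0 Qlin.
pose D n := `[< exists W : {vspace vT}, \dim W = n /\ forall x, x \in W -> Q x >].
have exD : exists n, D n.
  exists 0%N; apply/asboolP; exists 0%VS; split; first by rewrite dimv0.
  by move=> x; rewrite memv0 => /eqP ->.
have ubD n : D n -> (n <= \dim {:vT})%N.
  by move=> /asboolP [W [<- _]]; apply: dimvS; apply: subvf.
have [n /asboolP [W [dW WQ]] nmax] := ex_maxnP exD ubD.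
exists W => x; split=> [/WQ//|Qx]; apply: contraT => xW.
have /nmax : D (\dim (W + <[x]>)%VS); last first.
  by rewrite leqNgt -dW (ltn_leqif (dimv_leqif_sup _)) ?addvSl //
    subv_add subvv /= -memvE xW.
apply/asboolP; exists (W + <[x]>)%VS; split=> // y /memv_addP [w Ww [u /vlineP [k ->] ->]].
by rewrite addrC; apply: Qlin => //; apply: WQ.
Qed.

Section Coordinates.
Variables (C : numClosedFieldType) (N : nat).
Local Notation I := 'I_N.
Local Notation F := (seq 'I_N -> C^o).
Local Notation T m := (wspace C N m).
Implicit Types (f g h : F) (s : seq I) (m : nat).

(* Words are read from right to left: the recursive operators then extend a
   word at its end, which is where lattice words grow. *)
Definition cf m (x : T m) : F := fun s => oapp x 0 (insub (rev s)).
Definition mk m f : T m := [ffun w : m.-tuple I => f (rev w)].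

Lemma cf_linear m : linear (@cf m : T m -> F).
Proof.
move=> k x y; apply: wfP => s; rewrite !wfE /cf; case: insubP => [w _ _|_] /=.
  by rewrite !ffunE.
by rewrite mulr0 addr0.
Qed.
HB.instance Definition _ m := GRing.isLinear.Build C (T m) F *:%R (@cf m) (@cf_linear m).

Lemma cfD m (x y : T m) : cf (x + y) = cf x + cf y. Proof. exact: linearD. Qed.
Lemma cfN m (x : T m) : cf (- x) = - cf x. Proof. exact: linearN. Qed.
Lemma cfZ m k (x : T m) : cf (k *: x) = k *: cf x. Proof. exact: linearZ. Qed.
Lemma cf0 m : cf (0 : T m) = 0. Proof. exact: linear0. Qed.
Lemma cf_sum m (J : Type) (r : seq J) (p : pred J) (G : J -> T m) :
  cf (\sum_(i <- r | p i) G i) = \sum_(i <- r | p i) cf (G i).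
Proof. exact: linear_sum. Qed.
Definition cfE := (cfD, cfN, cfZ, cf0).

Lemma cf_rev m (x : T m) (w : m.-tuple I) : cf x (rev w) = x w.
Proof. by rewrite /cf revK valK. Qed.

Lemma cf_deg m (x : T m) : deg m (cf x).
Proof. by move=> s sm; rewrite /cf insubF // size_rev (negPf sm). Qed.

Lemma mkK m f : deg m f -> cf (mk m f) = f.
Proof.
move=> df; apply: wfP => s; have [sm|sm] := eqVneq (size s) m; last first.
  by rewrite df // cf_deg.
have rs : size (rev s) == m by rewrite size_rev sm.
by rewrite -[s]revK -[rev s]/(tval (Tuple rs)) cf_rev ffunE.
Qed.

Lemma cf_inj m : injective (@cf m).
Proof. by move=> x y e; apply/ffunP => w; rewrite -!cf_rev e. Qed.

Lemma dot_sum m f g :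
  dot m f g = \sum_(w : m.-tuple I) (f w : C) * (g w : C)^*.
Proof.
elim: m f g => [|m IH] f g.
  rewrite dot_nil (bigD1 [tuple]) //= big1 ?addr0 // => w /eqP [].
  exact: tuple0.
rewrite dotS (eq_bigr _ (fun c _ => IH (hd c f) (hd c g))) pair_big /=.
rewrite [RHS](reindex (fun p : I * m.-tuple I => cons_tuple p.1 p.2)) //=.
exists (fun w : m.+1.-tuple I => (thead w, behead_tuple w)) => [[c w]|w] _ /=.
  by congr pair; apply: val_inj.
by rewrite [w in RHS]tuple_eta.
Qed.

Lemma wdotE m (x y : T m) : wdot x y = dot m (cf x) (cf y).
Proof.
have revI : injective (fun w : m.-tuple I => rev_tuple w).
  by apply: (can_inj (g := fun w => rev_tuple w)) => w; apply: val_inj; apply: revK.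
rewrite dot_sum (reindex_inj revI).
by apply: eq_bigr => w _; rewrite /= !cf_rev.
Qed.

(** Gram-Schmidt: project onto one vector v of W, and by induction onto the part of W orthogonal to
    v. *)
Lemma orthogonal_split m (W : {vspace T m}) x :
  exists2 p, p \in W & forall w, w \in W -> wdot (x - p) w = 0.
Proof.
have [n] := ubnP (\dim W); elim: n W => // n IH W; rewrite ltnS => dW.
have [->|W0] := eqVneq W 0%VS.
  by exists 0; rewrite ?mem0v // => w; rewrite memv0 => /eqP ->; rewrite wdotE cf0 dot0r.
have v0 : vpick W != 0 by rewrite vpick0.
set v := vpick W in v0; have vW : v \in W by apply: memv_pick.
have vv : dot m (cf v) (cf v) != 0.
  rewrite gt_eqF // dot_gt0 //; first exact: cf_deg.
  by rewrite -(cf0 m) (inj_eq (@cf_inj m)).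
pose W' := (W :&: orthov (@wdot C N m) <[v]>)%VS.
have W'P w : (w \in W') = (w \in W) && (wdot v w == 0).
  by rewrite memv_cap; congr andb; rewrite mem_orthov1_sym; apply: mem_orthov1.
have dW' : (\dim W' < n)%N.
  apply: leq_trans dW; rewrite ltn_neqAle dimvS ?capvSl // andbT.
  apply: contraTN vW => /eqP e.
  have /eqP <- : W' == W by rewrite -(geq_leqif (dimv_leqif_eq (capvSl _ _))) e.
  by rewrite W'P wdotE (negPf vv) andbF.
have [p pW' pP] := IH W' dW'.
have /andP [pW /eqP vp] : (p \in W) && (wdot v p == 0) by rewrite -W'P.
pose c := wdot x v / wdot v v; exists (c *: v + p); first by rewrite memvD // memvZ.
have pv : wdot p v = 0 by rewrite wdotE dotC -wdotE vp conjC0.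
have xv : wdot (x - (c *: v + p)) v = 0.
  rewrite wdotE !cfE !dotE -!wdotE pv addr0 /c mulfVK ?subrr //.
  by rewrite wdotE.
move=> w wW; pose k := wdot w v / wdot v v.
have -> : w = k *: v + (w - k *: v) by rewrite addrC subrK.
have wv : wdot v (w - k *: v) = 0.
  rewrite wdotE dotC !cfE !dotE -!wdotE /k mulfVK ?subrr ?conjC0 //.
  by rewrite wdotE.
have w'W' : w - k *: v \in W' by rewrite W'P wv eqxx andbT memvB // memvZ.
rewrite wdotE [cf (_ + (_ - _))]cfD cfZ dotDr dotZr -!wdotE xv mulr0 add0r.
have := pP _ w'W'; rewrite !wdotE.
have -> : x - (c *: v + p) = (x - p) - c *: v by rewrite opprD addrA addrAC.
by rewrite [cf (_ - c *: v)]cfD cfN cfZ => e; rewrite dotDl e dotNl dotZl -!wdotE wv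
  mulr0 subr0.
Qed.

Lemma orthogonal_split_pred m (U : F -> Prop) f :
  U 0 -> (forall k g h, U g -> U h -> U (k *: g + h)) -> (forall g, U g -> deg m g) ->
  exists2 p, U p & forall u, U u -> dot m (f - p) u = 0.
Proof.
move=> U0 Ulin Udeg.
have [||W WP] := @vspace_of_pred _ (T m) (fun x => U (cf x)).
- by rewrite cf0.
- by move=> k x y Ux Uy; rewrite !cfE; apply: Ulin.
have [p /WP Up pP] := orthogonal_split W (mk m f).
exists (cf p) => // u Uu.
have := pP (mk m u); rewrite WP mkK; last exact: Udeg.
move=> /(_ Uu) <-; rewrite wdotE mkK; last exact: Udeg.
apply: dot_eq => // s sm; rewrite !cfE !wfE; congr (_ - _).
have rs : size (rev s) == m by rewrite size_rev sm.
by rewrite -[s]revK -[rev s]/(tval (Tuple rs)) cf_rev ffunE.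
Qed.

End Coordinates.

Section HighestWeightProjection.
Variables (C : numClosedFieldType) (N : nat).
Local Notation I := 'I_N.
Local Notation F := (seq 'I_N -> C^o).
Implicit Types (f g h p x y z : F) (s t : seq I) (a b c d : I) (m : nat) (lam mu : rowshape N).

Lemma hwproj_exists lam z :
  exists p, hwv lam p /\ forall h, hwv lam h -> dot (psize lam) (z - p) h = 0.
Proof.
have hlin k g h : hwv lam g -> hwv lam h -> hwv lam (k *: g + h).
  exact: hwv_linear.
have [p hp pP] := orthogonal_split_pred z (hwv0 C lam) hlin (@hwv_deg C N lam).
by exists p.
Qed.

(** The target is the space of all highest weight vectors of weight lam; [cf_orthoproj] identifies
    it with the Specht module once [spechtP] is available. *)
Definition hwproj lam z : F := sval (cid (hwproj_exists lam z)).

Lemma hwproj_hwv lam z : hwv lam (hwproj lam z).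
Proof. by rewrite /hwproj; case: cid => p []. Qed.

Lemma dot_hwproj lam z h : hwv lam h -> dot (psize lam) (hwproj lam z) h = dot (psize lam) z h.
Proof.
move=> hh; rewrite /hwproj; case: cid => p [_ /(_ h hh)] /= /eqP.
by rewrite dotDl dotNl subr_eq0 => /eqP.
Qed.

Lemma dot_hwprojr lam z h : hwv lam h -> dot (psize lam) h (hwproj lam z) = dot (psize lam) h z.
Proof. by move=> hh; rewrite dotC dot_hwproj // -dotC. Qed.

Lemma hwproj_unique lam z p : hwv lam p ->
  (forall h, hwv lam h -> dot (psize lam) p h = dot (psize lam) z h) -> hwproj lam z = p.
Proof.
move=> hp pP; apply/eqP; rewrite -subr_eq0; apply/eqP.
have hd : hwv lam (hwproj lam z - p) by apply: hwvB => //; apply: hwproj_hwv.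
by apply: (dot_eq0 (hwv_deg hd)); rewrite dotDl dotNl dot_hwproj // pP // subrr.
Qed.

Lemma hwproj_linear lam : linear (hwproj lam : F -> F).
Proof.
move=> k f g; apply: hwproj_unique => [|h hh].
  by apply: hwv_linear; apply: hwproj_hwv.
by rewrite !dotE !dot_hwproj.
Qed.
HB.instance Definition _ lam := GRing.isLinear.Build C F F *:%R (hwproj lam) (@hwproj_linear lam).

Definition intertwines m (P Q : F -> F) :=
  [/\ forall a b f, Emap a b (P f) = P (Emap a b f),
      forall a b f, Emap a b (Q f) = Q (Emap a b f),
      linear P, linear Q
    & forall f g, dot m (P f) g = dot m f (Q g)].

Lemma hwv_commute lam (P : F -> F) : linear P ->
  (forall a b f, Emap a b (P f) = P (Emap a b f)) -> forall f, hwv lam f -> hwv lam (P f).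
Proof.
move=> linP comP f [wf hf].
have P0 : P 0 = 0 by have := linP (-1) 0 0; rewrite scaler0 addr0 scaleN1r addNr.
split=> [a|a b ab]; rewrite comP; last by rewrite hf.
by rewrite wf; have := linP (lam a)%:R f 0; rewrite addr0 P0 addr0.
Qed.

(** Both P and its adjoint Q preserve highest weight vectors, so pairing [P z] with one of them only
    sees the projection of z. *)
Lemma hwproj_commute lam P Q z : intertwines (psize lam) P Q ->
  hwproj lam (P z) = P (hwproj lam z).
Proof.
case=> cP cQ lP lQ adj; apply: hwproj_unique.
  by apply: hwv_commute => //; apply: hwproj_hwv.
by move=> h hh; rewrite !adj dot_hwproj //; apply: hwv_commute.
Qed.

End HighestWeightProjection.

(** * Lifts and the module they generate *)

Section Lifting.
Variables (C : numClosedFieldType) (N : nat).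
Local Notation I := 'I_N.
Local Notation F := (seq 'I_N -> C^o).
Implicit Types (f g h p v x y z : F) (s t : seq I) (a b c d : I) (m n : nat)
  (lam mu kap : rowshape N).

(** Raising and lowering operators are adjoint, so within G the orthogonal complement of the images
    of the lowering operators is the common kernel of the raising ones. *)
Lemma relative_split (J : pred I) m (G : F -> Prop) z :
  G 0 -> (forall k g h, G g -> G h -> G (k *: g + h)) -> (forall g, G g -> deg m g) ->
  (forall a b g, J a -> J b -> G g -> G (Emap a b g)) -> G z ->
  exists p, [/\ G p, forall c d, J c -> J d -> (c < d)%N -> Emap c d p = 0
    & exists2 g : I * I -> F, forall q, G (g q) &
      z - p = \sum_(q | [&& J q.1, J q.2 & (q.1 < q.2)%N]) Emap q.2 q.1 (g q)].
Proof.
move=> G0 Glin Gdeg GE Gz.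
pose U u := exists2 g : I * I -> F, forall q, G (g q) &
  u = \sum_(q | [&& J q.1, J q.2 & (q.1 < q.2)%N]) Emap q.2 q.1 (g q).
have GD g h : G g -> G h -> G (g + h) by move=> Gg Gh; rewrite -[g]scale1r; apply: Glin.
have UG u : U u -> G u.
  case=> g Gg ->; elim/big_rec: _ => // q f /and3P [J1 J2 _] Gf.
  by apply: GD => //; apply: GE.
have [||| p' Up' p'P] := @orthogonal_split_pred C N m U z.
- by exists (fun=> 0) => //; rewrite big1 // => q _; rewrite Emap0.
- move=> k g h [g1 Gg1 ->] [g2 Gg2 ->]; exists (fun q => k *: g1 q + g2 q).
    by move=> q; apply: Glin.
  by rewrite scaler_sumr -big_split; apply: eq_bigr => q _; rewrite EmapD EmapZ.
- by move=> g /UG; apply: Gdeg.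
have Gp : G (z - p') by rewrite addrC -scaleN1r; apply: Glin => //; apply: UG.
exists (z - p'); split=> //; last first.
  by case: Up' => g Gg e; exists g => //; rewrite opprB addrC subrK.
move=> c d Jc Jd cd; have Gq : G (Emap c d (z - p')) by apply: GE.
apply: (dot_eq0 (Gdeg _ Gq)); rewrite dot_Emap p'P //.
exists (fun q => if q == (c, d) then Emap c d (z - p') else 0).
  by move=> q; case: ifP.
rewrite (bigD1 (c, d)) ?Jc ?Jd //= eqxx big1 ?addr0 // => q /andP [_ /negPf ->].
by rewrite Emap0.
Qed.

(** The remainder p of [relative_split] is killed by every raising operator: by construction inside
    J, by the assumption on G outside. So p is the full projection, although only lowering operators
    on J were used to reach it. *)
Lemma hwproj_relative (J : pred I) lam (G : F -> Prop) z :
  (forall a b, (a < b)%N -> J b -> J a) ->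
  G 0 -> (forall k g h, G g -> G h -> G (k *: g + h)) ->
  (forall g, G g -> deg (psize lam) g) ->
  (forall a b g, J a -> J b -> G g -> G (Emap a b g)) ->
  (forall a b g, (a < b)%N -> ~~ J b -> G g -> Emap a b g = 0) ->
  wt lam z -> G z ->
  G (hwproj lam z) /\ exists2 g : I * I -> F, forall q, G (g q) &
    z - hwproj lam z = \sum_(q | [&& J q.1, J q.2 & (q.1 < q.2)%N]) Emap q.2 q.1 (g q).
Proof.
move=> Jdown G0 Glin Gdeg GE Gkill wz Gz.
have [p [Gp pJ [g Gg zp]]] := relative_split G0 Glin Gdeg GE Gz.
have php a b : (a < b)%N -> Emap a b p = 0.
  move=> ab; have [Jb|Jb] := boolP (J b); last exact: Gkill.
  by apply: pJ => //; apply: Jdown ab Jb.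
have pz h : (forall a b, (a < b)%N -> Emap a b h = 0) ->
    dot (psize lam) p h = dot (psize lam) z h.
  move=> hh; apply/eqP; rewrite -subr_eq0 -dotNl -dotDl -opprB dotNl oppr_eq0 zp.
  rewrite dot_suml big1 // => q /and3P [_ _ q12].
  by rewrite dot_Emap hh // dot0r.
have Ediag_hw a f c d : (forall a b, (a < b)%N -> Emap a b f = 0) ->
    (c < d)%N -> Emap c d (Emap a a f) = 0.
  move=> hf cd; rewrite E_comm hf // Emap0 add0r.
  have -> : (d == a)%:R *: Emap c a f = 0.
    by have [<-|_] := eqVneq d a; rewrite ?scale0r // hf // scaler0.
  have -> : (c == a)%:R *: Emap a d f = 0.
    by have [<-|_] := eqVneq c a; rewrite ?scale0r // hf // scaler0.
  by rewrite subr0.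
(* Membership in G does not fix the weight of p. The defect q is killed by the raising operators, so
   pairing with it or with [Emap a a q] gives the same for p as for z, and z has weight lam. *)
have wp : wt lam p.
  move=> a; apply/eqP; rewrite -subr_eq0; apply/eqP; set q := _ - _.
  have hq c d : (c < d)%N -> Emap c d q = 0.
    by move=> cd; rewrite EmapD EmapN EmapZ Ediag_hw // php // scaler0 subrr.
  have dq : deg (psize lam) q.
    by apply: degD; [apply: deg_Emap | apply: degN; apply: degZ]; apply: Gdeg.
  suff: dot (psize lam) q q = 0 by move/(dot_eq0 dq).
  rewrite {1}/q dotDl dotNl dotZl dot_Emap.
  rewrite pz; last first.
    by move=> c d cd; apply: Ediag_hw.
  by rewrite pz // -dot_Emap wz dotZl subrr.
have <- : p = hwproj lam z.
  by apply/esym/hwproj_unique => // h [_ hh]; apply: pz.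
by split=> //; exists g.
Qed.

Definition shs t f : F := foldr (@shf C N) f t.

Lemma shs_cat t t' f : shs (t ++ t') f = shs t (shs t' f).
Proof. exact: foldr_cat. Qed.

Lemma shf_shs c t f : shf c (shs t f) = shs t (shf c f).
Proof. by elim: t => //= d t <-; rewrite sh_sh. Qed.

Lemma shs_perm t t' f : perm_eq t t' -> shs t f = shs t' f.
Proof.
move=> ptt'; apply: (catCA_perm_ind (P := fun t' => shs t f = shs t' f) _ ptt') => //.
move=> u1 u2 u3 ->; rewrite !shs_cat; elim: u2 (shs u3 f) => [//|c u2 IH] g /=.
by rewrite -shf_shs IH.
Qed.

Lemma shsZ t k f : shs t (k *: f) = k *: shs t f.
Proof. by elim: t => //= c t ->; rewrite shfZ. Qed.
Lemma shsD t f g : shs t (f + g) = shs t f + shs t g.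
Proof. by elim: t => //= c t ->; rewrite shfD. Qed.
Lemma shs0 t : shs t 0 = 0.
Proof. by elim: t => //= c t ->; rewrite shf0. Qed.
Lemma shsN t f : shs t (- f) = - shs t f.
Proof. by rewrite -scaleN1r shsZ scaleN1r. Qed.

Lemma Emap_shs a b t f : a \notin t -> Emap b a (shs t f) = shs t (Emap b a f).
Proof.
elim: t => //= c t IH; rewrite inE negb_or => /andP [/negPf ac /IH {}IH].
by rewrite E_sh ac scale0r addr0 IH.
Qed.

Lemma Emap_shs_sum a b t : exists l : seq (seq I),
  forall f, Emap b a (shs t f) = shs t (Emap b a f) + \sum_(u <- l) shs u f.
Proof.
elim: t => [|c t [l IH]]; first by exists [::] => f; rewrite big_nil addr0.
exists ([seq c :: u | u <- l] ++ (if a == c then [:: b :: t] else [::])) => f.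
rewrite /= E_sh IH shfD shf_sum big_cat big_map /= addrA; congr (_ + _).
by have [_|_] := eqVneq a c; rewrite ?big_seq1 ?scale1r ?big_nil ?scale0r.
Qed.

Definition addcells mu t : rowshape N := [ffun i => mu i + count_mem i t]%N.

Lemma addcells_cons mu a t : addcells mu (a :: t) = addcells (addcell mu a) t.
Proof. by apply/ffunP => i; rewrite !ffunE /= addnA [a == i]eq_sym. Qed.
Lemma addcells_nil mu : addcells mu [::] = mu.
Proof. by apply/ffunP => i; rewrite !ffunE addn0. Qed.

Lemma wt_shs mu t f : wt mu f -> wt (addcells mu t) (shs t f).
Proof.
elim: t => [|a t IH] wf; first by rewrite addcells_nil.
have -> : addcells mu (a :: t) = addcell (addcells mu t) a.
  by apply/ffunP => i; rewrite !ffunE /= [a == i]eq_sym addnCA addnC.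
by apply: wt_sh; apply: IH.
Qed.

Lemma dot_shs_wt n mu lam t x h : wt mu x -> wt lam h -> dot n (shs t x) h != 0 ->
  addcells mu t = lam.
Proof.
move=> wx wh; have [//|/eqP ne] := eqVneq (addcells mu t) lam.
by rewrite (wt_orth n (wt_shs t wx) wh ne) eqxx.
Qed.

(* The difference between sh_i x and its projection involves only the lowering
   operators on the rows above i, which commute with sh_j for j >= i. *)
Lemma dot_shs_hwproj kap lam (i : I) t x h n : hwv kap x -> hwv lam h ->
  {in t, forall j : I, i <= j}%N ->
  dot n (shs t (hwproj (addcell kap i) (shf i x))) h = dot n (shs t (shf i x)) h.
Proof.
move=> [wx hx] hh ti; pose J := [pred a : I | (a <= i)%N].
pose G g := deg (psize kap).+1 g /\ forall a b, (a < b)%N -> ~~ J b -> Emap a b g = 0.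
have [|||||||_ [g _ e]] := @hwproj_relative J (addcell kap i) G (shf i x) _ _ _ _ _ _ (wt_sh i wx).
- by move=> a b ab; rewrite !inE; apply: leq_trans (ltnW ab).
- by split=> [|a b _ _]; [apply: deg0 | rewrite Emap0].
- move=> k g1 g2 [d1 k1] [d2 k2]; split=> [|a b ab Jb]; first by apply: degD => //; apply: degZ.
  by rewrite EmapD EmapZ k1 // k2 // scaler0 addr0.
- by move=> g []; rewrite psize_addcell.
- move=> a b g Ja Jb [dg kg]; split=> [|c d cd Jd]; first exact: deg_Emap.
  have da : d == a = false.
    by apply: contraNF Jd => /eqP ->.
  rewrite E_comm da kg // Emap0 scale0r addr0 sub0r.
  have [cb|_] := eqVneq c b; last by rewrite scale0r oppr0.
  rewrite kg ?scaler0 ?oppr0 //.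
  by move: Ja Jd; rewrite !inE -ltnNge; apply: leq_ltn_trans.
- by move=> a b g ab Jb [_ kg]; apply: kg.
- split=> [|a b ab]; first by apply: deg_sh; apply: wt_deg.
  rewrite !inE -ltnNge => ib; rewrite E_sh hx // shf0 add0r.
  by rewrite (_ : (b == i) = false) ?scale0r //; apply: contraTF ib => /eqP ->; rewrite ltnn.
apply/eqP; rewrite eq_sym -subr_eq0 -dotNl -dotDl -shsN -shsD e.
have -> : shs t (\sum_(q | [&& J q.1, J q.2 & (q.1 < q.2)%N]) Emap q.2 q.1 (g q)) =
    \sum_(q | [&& J q.1, J q.2 & (q.1 < q.2)%N]) shs t (Emap q.2 q.1 (g q)).
  by elim/big_rec2: _ => [|q f1 f2 _ <-]; rewrite ?shs0 ?shsD.
rewrite dot_suml big1 // => q /and3P [_ Jq q12].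
rewrite -Emap_shs; first exact: hwv_dot_lower q12 hh _.
apply/negP => /ti; rewrite leqNgt => /negP []; apply: leq_trans q12 _.
exact: Jq.
Qed.

Fixpoint lifts kap (rs : seq I) x : F :=
  if rs is r :: rs' then lifts (addcell kap r) rs' (hwproj (addcell kap r) (shf r x)) else x.

Lemma lifts_hwv kap rs x : hwv kap x -> hwv (addcells kap rs) (lifts kap rs x).
Proof.
elim: rs kap x => [|r rs IH] kap x hx; first by rewrite addcells_nil.
by rewrite addcells_cons; apply: IH; apply: hwproj_hwv.
Qed.

(** As the rows increase, [dot_shs_hwproj] removes the intermediate projections one at a time. *)
Lemma dot_lifts kap lam rs x h n : sorted leq [seq val r | r <- rs] ->
  hwv kap x -> hwv lam h -> dot n (lifts kap rs x) h = dot n (shs rs x) h.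
Proof.
elim: rs kap x => [//|r rs IH] kap x srt hx hh.
rewrite /= IH ?(path_sorted srt) //; last exact: hwproj_hwv.
rewrite (dot_shs_hwproj _ hx hh) => [|j jrs].
  by rewrite shf_shs.
have := order_path_min leq_trans srt; move/allP => /(_ (val j)); apply.
exact: map_f.
Qed.

Lemma lifts_hwproj mu lam rs x : sorted leq [seq val r | r <- rs] ->
  hwv mu x -> addcells mu rs = lam -> lifts mu rs x = hwproj lam (shs rs x).
Proof.
move=> srt hx e; apply/esym/hwproj_unique => [|h hh]; first by rewrite -e; apply: lifts_hwv.
exact: (dot_lifts _ srt hx hh).
Qed.

Definition killed x := forall b, delf b x = 0.

(** Only lowering operators here, and only insertions in [generated], are allowed as generators:
    this is the triangular decomposition. Stability under the other operators is then a lemma about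
    the vector x: [lowered_Emap], [gen_Emap], [gen_de]. *)
Inductive lowered x : F -> Prop :=
| lowered_id : lowered x x
| lowered_E a b v : (a < b)%N -> lowered x v -> lowered x (Emap b a v)
| lowered_lin k v w : lowered x v -> lowered x w -> lowered x (k *: v + w).

(* The u(N,1)-module generated by x, in degree m. *)
Inductive generated mu x : nat -> F -> Prop :=
| gen_lowered v : lowered x v -> generated mu x (psize mu) v
| gen_sh a m v : generated mu x m v -> generated mu x m.+1 (shf a v)
| gen_0 m : generated mu x m 0
| gen_lin k m v w : generated mu x m v -> generated mu x m w -> generated mu x m (k *: v + w).

Lemma genZ mu x m k v : generated mu x m v -> generated mu x m (k *: v).
Proof. by move=> gv; rewrite -[_ *: _]addr0; apply: gen_lin => //; apply: gen_0. Qed.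
Lemma genD mu x m v w : generated mu x m v -> generated mu x m w -> generated mu x m (v + w).
Proof. by move=> gv gw; rewrite -[v]scale1r; apply: gen_lin. Qed.

Lemma lowered0 x : lowered x 0.
Proof. by rewrite -(addNr x) -scaleN1r; apply: lowered_lin; apply: lowered_id. Qed.
Lemma loweredZ x k v : lowered x v -> lowered x (k *: v).
Proof. by move=> gv; rewrite -[_ *: _]addr0; apply: lowered_lin => //; apply: lowered0. Qed.
Lemma loweredD x v w : lowered x v -> lowered x w -> lowered x (v + w).
Proof. by move=> gv gw; rewrite -[v]scale1r; apply: lowered_lin. Qed.

Lemma lowered_Emap mu x v a b : hwv mu x -> lowered x v -> lowered x (Emap a b v).
Proof.
move=> [wx hx] lv; elim: lv a b => {v} [|c d v cd lv IH|k v w lv IHv lw IHw] a b.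
- have [ab|ba|/val_inj ->] := ltngtP a b.
  + by rewrite hx //; apply: lowered0.
  + by apply: lowered_E => //; apply: lowered_id.
  + by rewrite wx; apply: loweredZ; apply: lowered_id.
- rewrite E_comm -scaleNr; apply: loweredD; last by apply: loweredZ; apply: IH.
  apply: loweredD; last by apply: loweredZ; apply: IH.
  by apply: lowered_E => //; apply: IH.
- by rewrite EmapD EmapZ; exact: (lowered_lin k (IHv _ _) (IHw _ _)).
Qed.

Lemma gen_Emap mu x m v a b : hwv mu x -> generated mu x m v -> generated mu x m (Emap a b v).
Proof.
move=> hx gv; elim: gv a b => {m v} [v lv|c m v gv IH|m|k m v w gv IHv gw IHw] a b.
- by apply: gen_lowered; apply: lowered_Emap hx lv.
- by rewrite E_sh; apply: genD; [|apply: genZ]; apply: gen_sh => //; apply: IH.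
- by rewrite Emap0; apply: gen_0.
- by rewrite EmapD EmapZ; exact: (gen_lin k (IHv _ _) (IHw _ _)).
Qed.

Lemma gen_deg mu x m v : hwv mu x -> generated mu x m v -> deg m v.
Proof.
move=> hx; elim=> {m v} [v|c m v _ dv|m|k m v w _ dv _ dw].
- elim=> [|a b w _ _ dw|k u w _ du _ dw]; [exact: hwv_deg|exact: deg_Emap|].
  by apply: degD => //; apply: degZ.
- exact: deg_sh.
- exact: deg0.
- by apply: degD => //; apply: degZ.
Qed.

Lemma killed_lowered mu x v b : hwv mu x -> killed x -> lowered x v -> delf b v = 0.
Proof.
move=> hx kx lv; elim: lv b => {v} [|c d v cd lv IH|k v w lv IHv lw IHw] b //.
- have := E_de d c b v; rewrite !IH Emap0 scaler0 subr0 => <-.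
  by [].
- by rewrite delfD delfZ IHv IHw scaler0 addr0.
Qed.

Lemma gen_de mu x m v b : hwv mu x -> killed x ->
  generated mu x m v -> generated mu x m.-1 (delf b v).
Proof.
move=> hx kx gv; elim: gv b => {m v} [v lv|c m v gv IH|m|k m v w gv IHv gw IHw] b.
- by rewrite (killed_lowered b hx kx lv); apply: gen_0.
- have dv := gen_deg hx gv.
  rewrite de_sh (deg1E dv) /=; apply: genD; last by do 2 apply: genZ.
  apply: genD; last exact: gen_Emap.
  (* Inserting after deleting returns to degree m only if m > 0; in degree 0 the deletion is
     zero. *)
  case: m gv IH dv => [|m] gv IH dv; last by apply: gen_sh; apply: IH.
  by rewrite deg_de0 // shf0; apply: gen_0.
- by rewrite delf0; apply: gen_0.
- by rewrite delfD delfZ; exact: (gen_lin k (IHv _) (IHw _)).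
Qed.

Lemma gen_shs mu x t : generated mu x (size t + psize mu) (shs t x).
Proof.
by elim: t => [|a t IH] /=; [apply: gen_lowered; apply: lowered_id | apply: gen_sh].
Qed.

Lemma gen_hwproj mu x lam z : hwv mu x -> wt lam z -> generated mu x (psize lam) z ->
  generated mu x (psize lam) (hwproj lam z).
Proof.
move=> hx wz gz.
have [||||||gp _] // := @hwproj_relative xpredT lam (generated mu x (psize lam)) z _ _ _ _ _ _ wz gz.
- exact: gen_0.
- by move=> k g h; apply: gen_lin.
- by move=> g; apply: gen_deg.
- by move=> a b g _ _; apply: gen_Emap.
Qed.

(** A lowering operator can be moved to the far left, where it vanishes against h, at the price of
    insertions of other words. Hence pure insertions into x decide. *)
Lemma gen_dot0 mu x m z lam h n : hwv lam h ->
  (forall t, dot n (shs t x) h = 0) -> generated mu x m z -> forall t, dot n (shs t z) h = 0.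
Proof.
move=> hh x0 gz; elim: gz => {m z} [v lv|c m v gv IH|m|k m v w gv IHv gw IHw] t.
- elim: lv t => {v} [|c d v cd lv IH|k v w lv IHv lw IHw] t //.
    have [l lP] := Emap_shs_sum c d t.
    have -> : shs t (Emap d c v) = Emap d c (shs t v) - \sum_(u <- l) shs u v.
      by rewrite lP addrK.
    rewrite dotDl (hwv_dot_lower _ cd hh) dotNl dot_suml big1 ?subr0 // => u _; exact: IH.
  by rewrite shsD shsZ dotDl dotZl IHv IHw mulr0 addr0.
- by have := IH (rcons t c); rewrite -cats1 shs_cat.
- by rewrite shs0 dot0l.
- by rewrite shsD shsZ dotDl dotZl IHv IHw mulr0 addr0.
Qed.

(** A killed highest weight vector is orthogonal to whatever an insertion or a lowering operator
    produces; only x' itself remains, and it has another weight. *)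
Lemma gen_killed_orth mu mu' x x' z n : hwv mu x -> hwv mu' x' -> killed x ->
  mu <> mu' -> generated mu' x' n z -> psize mu = n -> dot n x z = 0.
Proof.
move=> hx hx' kx mumu'; elim=> {n z} [v|c m v _ _ _|m _|k m v w _ IHv _ IHw e].
- elim=> {v} [|a b w ab _ _|k v w _ IHv _ IHw] e.
  + by apply: wt_orth (proj1 hx) (proj1 hx') mumu'.
  + by apply: dot_eq0C; apply: (hwv_dot_lower _ ab hx).
  + by rewrite dotDr dotZr IHv // IHw // mulr0 addr0.
- by rewrite -dot_de kx dot0l.
- exact: dot0r.
- by rewrite dotDr dotZr IHv // IHw // mulr0 addr0.
Qed.

(** The generators of z pass to the other side as their adjoints, under which the module of x' is
    stable, until x alone is left. *)
Lemma gen_orth mu mu' x x' m z z' : hwv mu x -> hwv mu' x' -> killed x -> killed x' ->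
  mu <> mu' -> generated mu x m z -> generated mu' x' m z' -> dot m z z' = 0.
Proof.
move=> hx hx' kx kx' mumu' gz.
elim: gz z' => {m z} [v lv|c m v gv IH|m|k m v w gv IHv gw IHw] z' gz'.
- elim: lv z' gz' => {v} [|c d v cd lv IH|k v w lv IHv lw IHw] z' gz'.
  + by apply: gen_killed_orth hx hx' kx mumu' gz' _.
  + by rewrite dot_Emap IH //; apply: gen_Emap.
  + by rewrite dotDl dotZl IHv // IHw // mulr0 addr0.
- by rewrite dot_sh IH //; apply: (gen_de c hx' kx' gz').
- exact: dot0l.
- by rewrite dotDl dotZl IHv // IHw // mulr0 addr0.
Qed.

(* For the largest b such that the image of h under the deletion of b is not 0,
   this image is again a highest weight vector. *)
Lemma hwv_reach lam h : hwv lam h -> h <> 0 -> exists mu x t,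
  [/\ hwv mu x, killed x & dot (psize lam) (shs t x) h != 0].
Proof.
have [n] := ubnP (psize lam); elim: n lam h => // n IH lam h; rewrite ltnS => lamn hh h0.
have [kh|] := pselect (killed h).
  exists lam, h, [::]; split=> //=; rewrite gt_eqF // dot_gt0 //; first exact: hwv_deg.
  exact/eqP.
move=> /existsNP /= exb.
have [b0 b0P] : exists b : I, delf b h != 0 by case: exb => b hb; exists b; apply/eqP.
have [b bP bmax] := @arg_maxnP _ b0 (fun b => delf b h != 0) val b0P.
have [wh rh] := hh.
(* With lam_b = 0 the vector [delf b h] would have weight -1 at b, but [Emap b b] counts letters. *)
have lamb : (0 < lam b)%N.
  rewrite lt0n; apply: contraNneq bP => lam0; apply/eqP/wfP => s.
  have /(congr1 (fun k : F => k s)) := E_de b b b h.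
  rewrite wh lam0 scale0r delf0 eqxx scale1r sub0r Emap_diag !wfE => /eqP.
  rewrite -subr_eq0 opprK -[X in _ + X]mul1r -mulrDl mulf_eq0 natr1 pnatr_eq0.
  by move=> /eqP.
pose kap : rowshape N := [ffun i => lam i - (i == b)]%N.
have lamE : lam = addcell kap b.
  by apply/ffunP => i; rewrite !ffunE; have [->|_] := eqVneq i b; rewrite /= ?subn0 ?addn0 // subnK.
have wg : wt kap (delf b h) by apply: wt_de; rewrite -lamE.
have hg : hwv kap (delf b h).
  split=> // c d cd; rewrite E_de rh // delf0 sub0r.
  (* For c = b the commutator leaves the deletion of d > b, which is 0 by the choice of b. *)
  have [cb|_] := eqVneq c b; last by rewrite scale0r oppr0.
  rewrite scale1r; apply/eqP; rewrite oppr_eq0; apply: contraTT cd => dh.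
  by rewrite -leqNgt cb; apply: bmax.
have [||mu [x [t [hx kx xt]]]] := IH kap (delf b h) _ hg.
- by rewrite lamE psize_addcell in lamn.
- exact/eqP.
exists mu, x, (b :: t); split=> //.
by rewrite lamE psize_addcell /= dot_sh.
Qed.

End Lifting.

(** * Non-horizontal strips and eigenvalues *)

Section StripsAndEigenvalues.
Variables (C : numClosedFieldType) (N : nat).
Local Notation I := 'I_N.
Local Notation F := (seq 'I_N -> C^o).
Implicit Types (f g h v x y z : F) (s t : seq I) (a b c d : I) (m n : nat)
  (lam mu kap : rowshape N).

Lemma Emap_shs_nseq a b p f : Emap b a (shs (nseq p a) f) =
  shs (nseq p a) (Emap b a f) + p%:R *: shs (b :: nseq p.-1 a) f.
Proof.
elim: p => [|p IH]; first by rewrite scale0r addr0.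
rewrite [nseq p.+1 a]/= /= E_sh IH eqxx scale1r shfD shfZ -addrA; congr (_ + _).
case: p {IH} => [|p]; first by rewrite scale0r add0r scale1r.
by rewrite /= (sh_sh a b) -[p.+2%:R]natr1 scalerDl scale1r.
Qed.

(** Against h, an inserted b can be traded for an inserted a together with [Emap b a] applied to y,
    up to a nonzero factor. After r trades y has become 0. *)
Lemma strip_vanish lam a b h n r p q t y : (a < b)%N -> hwv lam h -> a \notin t ->
  (r <= q)%N -> iter r (Emap b a) y = 0 ->
  dot n (shs (nseq p a ++ nseq q b ++ t) y) h = 0.
Proof.
move=> ab hh at_; elim: r p q y => [|r IH] p q y.
  by move=> _ /= ->; rewrite shs0 dot0l.
case: q => // q; rewrite ltnS => rq; rewrite iterSr => Fy.
have := IH p.+1 q (Emap b a y) rq Fy; rewrite shs_cat.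
have aqt : a \notin nseq q b ++ t.
  by rewrite mem_cat negb_or at_ andbT mem_nseq negb_and -(inj_eq val_inj) neq_ltn ab orbT.
rewrite -(Emap_shs b _ aqt).
have /(congr1 (fun k => k - p.+1%:R *: shs (b :: nseq p a) (shs (nseq q b ++ t) y))) :=
  Emap_shs_nseq a b p.+1 (shs (nseq q b ++ t) y).
rewrite /= addrK => <-.
rewrite dotDl (hwv_dot_lower _ ab hh) add0r dotNl dotZl => /eqP.
rewrite oppr_eq0 mulf_eq0 pnatr_eq0 /= => /eqP <-.
by rewrite shs_cat /= -shf_shs.
Qed.

(** With d = mu_a - mu_b, raising the vector number d + 1 of the string gives (d + 1)(mu_a - mu_b -
    d) = 0 times vector number d; by adjointness its squared norm is 0. *)
Lemma hwv_sl2 mu x a b : (a < b)%N -> hwv mu x -> (mu b <= mu a)%N ->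
  iter (mu a - mu b).+1 (Emap b a) x = 0.
Proof.
move=> ab hx lemu; have [wx rx] := hx.
have nab : (a == b) = false by apply: contraTF ab => /eqP ->; rewrite ltnn.
have wa r : Emap a a (iter r (Emap b a) x) = ((mu a)%:R - r%:R) *: iter r (Emap b a) x.
  elim: r => [|r IH] /=; first by rewrite subr0 wx.
  rewrite E_comm IH nab eqxx EmapZ scale0r addr0 scale1r -[in RHS]natr1 opprD addrA.
  by rewrite [in RHS]scalerBl scale1r.
have wb r : Emap b b (iter r (Emap b a) x) = ((mu b)%:R + r%:R) *: iter r (Emap b a) x.
  elim: r => [|r IH] /=; first by rewrite addr0 wx.
  rewrite E_comm IH [b == a]eq_sym nab eqxx EmapZ scale0r subr0 scale1r -[in RHS]natr1 addrA.
  by rewrite [in RHS]scalerDl scale1r.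
have Eab r : Emap a b (iter r.+1 (Emap b a) x) =
    (r.+1%:R * ((mu a)%:R - (mu b)%:R - r%:R)) *: iter r (Emap b a) x.
  elim: r => [|r IH].
    rewrite /= E_comm rx // Emap0 add0r !eqxx !scale1r !wx -scalerBl.
    by congr (_ *: _); ring.
  rewrite [iter r.+2 _ _]iterS E_comm IH !eqxx !scale1r wa wb EmapZ -iterS.
  by rewrite -scalerDl -scalerBl; congr (_ *: _); rewrite -!natr1; ring.
set d := (mu a - mu b)%N; have dd : deg (psize mu) (iter d.+1 (Emap b a) x).
  by elim: d.+1 => [|k IH]; [apply: hwv_deg | apply: deg_Emap].
suff: dot (psize mu) (iter d.+1 (Emap b a) x) (iter d.+1 (Emap b a) x) = 0.
  by move/(dot_eq0 dd).
rewrite {1}iterS dot_Emap Eab natrB // subrr mulr0 scale0r dot0r //.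
Qed.

Lemma dot_shs_nonstrip n mu lam x t h a b : (a < b)%N -> (mu b <= mu a < lam b)%N ->
  hwv mu x -> hwv lam h -> addcells mu t = lam -> dot n (shs t x) h = 0.
Proof.
move=> ab /andP [lemu ltlam] hx hh e.
have qb : count_mem b t = (lam b - mu b)%N by rewrite -e ffunE addKn.
pose t' := [seq i <- t | (i != a) && (i != b)].
have ptt' : perm_eq t (nseq (count_mem a t) a ++ nseq (count_mem b t) b ++ t').
  have nba : (b == a) = false by apply: contraTF ab => /eqP ->; rewrite ltnn.
  apply/allP => i _; rewrite /= !count_cat !count_nseq count_filter /=.
  have -> : count (predI (pred1 i) (fun j => (j != a) && (j != b))) t =
      (if (i == a) || (i == b) then 0 else count_mem i t)%N.
    case: ifP => [iab|/negbT]; last rewrite negb_or => /andP [ia ib].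
      rewrite -(count_pred0 t); apply: eq_count => j /=.
      have [->|//] := eqVneq j i; apply/negbTE; rewrite -negb_or negbK //.
    by apply: eq_count => j /=; have [->|] := eqVneq j i; rewrite //= ia ib.
  rewrite [a == i]eq_sym [b == i]eq_sym; have [->|ia] := altP (i =P a).
    by rewrite ?eqxx [a == b]eq_sym nba /=; apply/eqP; lia.
  by have [->|ib] := altP (i =P b); rewrite ?eqxx /=; apply/eqP; lia.
(* The lam_b - mu_b inserted letters b suffice for mu_a - mu_b + 1 trades exactly because mu_a <
   lam_b. *)
rewrite (shs_perm _ ptt') (strip_vanish _ _ ab hh (r := (mu a - mu b).+1)) //.
- by rewrite mem_filter eqxx.
- by rewrite qb; lia.
- exact: hwv_sl2.
Qed.

Lemma hwproj_lower lam a b z : (a < b)%N -> hwproj lam (Emap b a z) = 0.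
Proof.
move=> ab; apply: hwproj_unique => [|h hh]; first exact: hwv0.
by rewrite dot0l (hwv_dot_lower _ ab hh).
Qed.

Definition r2r f : F := \sum_a shf a (delf a f).

Fact r2r_linear : linear r2r.
Proof.
move=> k f g; rewrite /r2r scaler_sumr -big_split.
by apply: eq_bigr => a _; rewrite delfD delfZ shfD shfZ.
Qed.
HB.instance Definition _ := GRing.isLinear.Build C F F *:%R r2r r2r_linear.

Lemma E_r2r a b f : Emap a b (r2r f) = r2r (Emap a b f).
Proof.
rewrite /r2r Emap_sum.
rewrite (eq_bigr (fun c => shf c (delf c (Emap a b f)) +
  ((b == c)%:R *: shf a (delf c f) - (a == c)%:R *: shf c (delf b f)))); last first.
  by move=> c _; rewrite E_sh E_de shfD shfN shfZ -addrA [- _ + _]addrC.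
rewrite big_split -[RHS]addr0; congr (_ + _); rewrite /= sumrB.
rewrite (bigD1 b) //= eqxx scale1r big1 ?addr0 => [|c /negPf cb]; last first.
  by rewrite eq_sym cb scale0r.
rewrite (bigD1 a) //= eqxx scale1r big1 ?addr0 ?subrr // => c /negPf ca.
by rewrite eq_sym ca scale0r.
Qed.

Lemma dot_r2r m f g : dot m (r2r f) g = \sum_a (if m is m'.+1 then dot m' (delf a f) (delf a g) else 0).
Proof.
rewrite dot_suml; apply: eq_bigr => a _; case: m => [|m]; last by rewrite dot_sh.
by rewrite dot_nil sh_nil mul0r.
Qed.

Lemma r2r_intertwines m : intertwines m r2r r2r.
Proof.
split; [exact: E_r2r | exact: E_r2r | exact: r2r_linear | exact: r2r_linear | move=> f g].
rewrite dot_r2r dotC dot_r2r rmorph_sum; apply: eq_bigr => a _ /=.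
by case: m => [|m]; rewrite ?rmorph0 // dotC.
Qed.

(** Pairing [r2r f] with f gives the sum of the squared norms of all [delf a f]. *)
Lemma r2r_eq0 m f : deg m f -> r2r f = 0 -> killed f.
Proof.
move=> df rf b; case: m df => [|m] df; first exact: deg_de0.
have := dot_r2r m.+1 f f; rewrite rf dot0l => /esym/psumr_eq0P s0.
by apply: (dot_eq0 (@deg_de _ _ _ b _ df)); apply: s0 => // a _; apply: dot_ge0.
Qed.

Lemma killed_r2r f : killed f -> r2r f = 0.
Proof. by move=> kf; rewrite /r2r big1 // => a _; rewrite kf shf0. Qed.

Lemma r2r_sh i m f : deg m f ->
  r2r (shf i f) = shf i (r2r f) + \sum_a shf a (Emap i a f) + m.+1%:R *: shf i f.
Proof.
move=> df; rewrite /r2r (eq_bigr (fun a => shf i (shf a (delf a f)) + shf a (Emap i a f) +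
   (i == a)%:R *: shf a (m.+1%:R *: f))); last first.
  by move=> a _; rewrite de_sh !shfD shfZ (deg1E df) (sh_sh a i).
rewrite !big_split /= shf_sum; congr (_ + _ + _).
rewrite (bigD1 i) //= eqxx scale1r shfZ big1 ?addr0 // => a /negPf ai.
by rewrite eq_sym ai scale0r.
Qed.

Lemma count_below (i : I) : \sum_(a : I | (a < i)%N) (1 : C) = i%:R.
Proof. by rewrite -(big_ord_widen N (fun=> 1 : C)) ?sumr_const ?card_ord // ltnW. Qed.

(** Origin of the content of the new cell. For each of the i rows a above, moving the lowering
    operator to the left, where the projection kills it, leaves -1; row i gives kap_i; the rows
    below give 0 because the operator is raising. *)
Lemma hwproj_sum_sh lam i kap y : hwv kap y ->
  hwproj lam (\sum_a shf a (Emap i a y)) = ((kap i)%:R - i%:R) *: hwproj lam (shf i y).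
Proof.
move=> [wy ry]; rewrite linear_sum (bigID (fun a : I => (a < i)%N)) /=.
rewrite (eq_bigr (fun=> - hwproj lam (shf i y))); last first.
  move=> a ai; have /(congr1 (fun k => hwproj lam (k - shf i y))) := E_sh i a a y.
  by rewrite eqxx scale1r addrK => <-; rewrite linearB /= hwproj_lower // sub0r.
rewrite [X in _ + X](bigD1 i) ?ltnn //= wy shfZ linearZ /= [X in _ + (_ + X)]big1 ?addr0; last first.
  move=> a; rewrite -leqNgt leq_eqVlt -(inj_eq val_inj) [val a == _]eq_sym => /andP [/orP [->//|ia] _].
  by rewrite ry // shf0 linear0.
rewrite addrC scalerBl; congr (_ + _).
rewrite -count_below scaler_suml -sumrN; apply: eq_bigr => a _.
by rewrite scale1r.
Qed.

Lemma r2r_lift kap i y : hwv kap y -> let P := hwproj (addcell kap i) in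
  r2r (P (shf i y)) = P (shf i (r2r y)) +
    ((psize kap).+1%:R + (kap i)%:R - i%:R) *: P (shf i y).
Proof.
move=> hy P; rewrite /P -(hwproj_commute _ (r2r_intertwines _)) (r2r_sh i (hwv_deg hy)).
rewrite !linearD linearZ /= (hwproj_sum_sh _ _ hy) -addrA -scalerDl; congr (_ + _ *: _).
ring.
Qed.

(* A potential whose increment from mu to lam is eig lam mu. *)
Definition content_weight kap : int :=
  'C((psize kap).+1, 2)%:Z + \sum_i ('C(kap i, 2)%:Z - (i * kap i)%N%:Z).

Lemma content_weight_addcell kap i :
  content_weight (addcell kap i) = content_weight kap + ((psize kap).+1%:Z + (kap i)%:Z - i%:Z).
Proof.
rewrite /content_weight psize_addcell binS bin1 (bigD1 i) //= [in RHS](bigD1 i) //=.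
rewrite (eq_bigr (fun j => 'C(kap j, 2)%:Z - (j * kap j)%N%:Z)) => [|j /negPf ji]; last first.
  by rewrite ffunE ji addn0.
have e2 : 'C((kap i).+1, 2) = ('C(kap i, 2) + kap i)%N by rewrite binS bin1.
rewrite ffunE eqxx addn1 e2 mulnS; set S := \sum_(j | _) _.
by rewrite !PoszD; ring.
Qed.

Lemma r2r_lifts mu rs x : hwv mu x -> killed x ->
  r2r (lifts mu rs x) =
    (content_weight (addcells mu rs) - content_weight mu)%:~R *: lifts mu rs x.
Proof.
move=> hx kx; suff gen kap y (e : C) : hwv kap y -> r2r y = e *: y ->
    r2r (lifts kap rs y) =
      (e + (content_weight (addcells kap rs) - content_weight kap)%:~R) *: lifts kap rs y.
  by rewrite (gen _ _ 0) ?add0r // killed_r2r // scale0r.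
elim: rs kap y e => [|r rs IH] kap y e hy ey.
  by rewrite addcells_nil subrr addr0.
rewrite /= addcells_cons.
have /= e' := r2r_lift r hy; rewrite ey shfZ linearZ /= -scalerDl in e'.
rewrite (IH _ _ _ (hwproj_hwv _ _) e'); congr (_ *: _).
rewrite content_weight_addcell !(rmorphB, rmorphD) /= -!pmulrn; ring.
Qed.

End StripsAndEigenvalues.

(** * Specht modules and lattice words *)

Section Lattice.
Variables (C : numClosedFieldType) (N : nat).
Local Notation I := 'I_N.
Local Notation F := (seq 'I_N -> C^o).
Implicit Types (f g h v x y z : F) (s w : seq I) (a b c d : I) (m n : nat)
  (lam mu kap : rowshape N).

(** Every suffix has partition content: as [cf] reads words backwards, these are the reversed words
    of standard tableaux. *)
Fixpoint lattice s : bool :=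
  if s is c :: s' then lattice s' && is_partition (cont s) else true.

Lemma lattice_drop k s : lattice s -> lattice (drop k s).
Proof. by elim: s k => [|c s IH] [|k] //= /andP [ls _]; apply: IH. Qed.

Lemma cont_cons c s : cont (c :: s) = addcell (cont s) c.
Proof. by apply/ffunP => i; rewrite !ffunE /= addnC [c == i]eq_sym. Qed.

Lemma cont_perm s s' : perm_eq s s' -> cont s = cont s'.
Proof. by move=> /seq.permP p; apply/ffunP => i; rewrite !ffunE p. Qed.

Lemma cont_rev s : cont (rev s) = cont s.
Proof. by apply: cont_perm; rewrite perm_rev. Qed.

Lemma lattice_partition s : lattice s -> is_partition (cont s).
Proof.
case: s => [_|c s /andP [] //]; apply/forallP => i; apply/forallP => j.
by rewrite !ffunE implybT.
Qed.

Lemma Emap_hd a b c f : Emap a b (hd c f) = hd c (Emap a b f) - (c == a)%:R *: hd b f.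
Proof. by rewrite hd_E addrC addKr. Qed.

Lemma wf_neq0 f : f <> 0 -> exists s, f s != 0.
Proof.
move=> f0; apply: contrapT => /forallNP ns; apply: f0; apply: wfP => s.
by apply/eqP; apply: contrapT => /negP; apply: ns.
Qed.

(** Fixing the first letter to a commutes with [Emap c d] except for c = a, where the slice at d
    appears. For the largest a with a nonzero slice this term is 0. *)
Lemma hwv_last_letter lam f : hwv lam f -> f [::] = 0 -> f <> 0 ->
  exists a kap, [/\ lam = addcell kap a, hwv kap (hd a f) & hd a f <> 0].
Proof.
move=> [wf rf] f0 fN0; have [[|a0 s0] fs0] := wf_neq0 fN0; first by rewrite f0 eqxx in fs0.
have ha0 : hd a0 f != 0 by apply: contra_neq fs0 => /(congr1 (fun k : F => k s0)).
have [a aP amax] := @arg_maxnP _ a0 (fun a => hd a f != 0) val ha0.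
have [s1 fs1] := wf_neq0 (elimN eqP aP).
have lamE : lam = addcell (cont s1) a.
  by rewrite -cont_cons; apply/esym; move/wtP: wf; apply.
exists a, (cont s1); split=> //; last exact/eqP.
split=> [|c d cd]; first by apply: wt_hd; rewrite -lamE.
rewrite Emap_hd rf // hd0 sub0r; have [ac|_] := eqVneq a c; last by rewrite scale0r oppr0.
rewrite scale1r; apply/eqP; rewrite oppr_eq0; apply: contraTT cd => dh.
by rewrite -leqNgt -ac; apply: amax.
Qed.

(** Iterating [hwv_last_letter] on a nonzero f reads off a lattice word in its support: all weights
    met on the way are partitions. *)
Lemma lattice_inj lam f : hwv lam f -> (forall s, lattice s -> f s = 0) -> f = 0.
Proof.
have [n] := ubnP (psize lam); elim: n lam f => // n IH lam f; rewrite ltnS => lamn hf f0.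
apply: contrapT => fN0; have pl := hwv_partition hf fN0.
have [a [kap [lamE hk hN0]]] := hwv_last_letter hf (f0 [::] isT) fN0.
apply: hN0; apply: (IH kap) => //; first by rewrite lamE psize_addcell in lamn.
move=> s ls; apply/eqP; apply: contraT => fs.
have e : cont (a :: s) = lam by have [/wtP wf _] := hf; apply: wf.
by move: fs; rewrite /hd f0 ?eqxx // /= ls e.
Qed.

(* Encodes the lexicographic order on words: the first letter is the last entry
   of s. *)
Definition key s : nat := foldr (fun c r => r * N + c)%N 0%N s.

Lemma key_bound s : (key s < N ^ size s)%N.
Proof.
elim: s => //= c s IH; rewrite expnS; have := ltn_ord c.
by move: IH; set k := key s; set M := (N ^ _)%N; nia.
Qed.

Lemma key_lt (p q q' : seq I) a b : size q = size q' -> (a < b)%N ->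
  (key (q ++ a :: p) < key (q' ++ b :: p))%N.
Proof.
elim: q q' => [|c q IH] [|c' q'] //= => [_ ab|[e] ab]; first by rewrite ltn_add2l.
have := IH _ e ab; have := ltn_ord c.
by set k := key _; set k' := key _; nia.
Qed.

End Lattice.

(** * Specht modules as spaces of highest weight vectors *)

Section Tableaux.
Variables (C : numClosedFieldType) (N : nat).
Local Notation I := 'I_N.
Local Notation F := (seq 'I_N -> C^o).
Variable lam : rowshape N.
Hypothesis plam : is_partition lam.
Local Notation n := (psize lam).
Implicit Types (t : tableau lam) (s w : seq I) (a b c d : I).

Lemma cell_eq (p q : cell lam) : crow p = crow q -> ccol p = ccol q -> p = q.
Proof.
case: p q => [i j] [i' j']; rewrite /crow /ccol /= => e; subst i'; rewrite /tagged /=.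
by move=> /val_inj ->.
Qed.

Lemma card_cell : #|{: cell lam}| = n.
Proof.
by rewrite card_tagged sumnE big_map big_enum; apply: eq_bigr => i _; rewrite card_ord.
Qed.

Lemma tableau_bij t : is_tableau t -> bijective t.
Proof.
by move=> /injectiveP tinj; apply: inj_card_bij => //; rewrite card_cell card_ord.
Qed.

Lemma tab_act_tableau t (sg : 'S_n) : is_tableau t -> is_tableau (tab_act sg t).
Proof.
move=> /injectiveP tinj; apply/injectiveP => k l; rewrite !ffunE => /tinj.
exact: perm_inj.
Qed.

Lemma cont_word t : is_tableau t -> cont (word t) = lam.
Proof.
move=> /tableau_bij bij; apply/ffunP => i; rewrite ffunE /=.
rewrite count_map -sum1_count big_enum_cond /=.
transitivity (\sum_(p : cell lam | crow p == i) 1)%N.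
  by rewrite [RHS](reindex t (onW_bij _ bij)).
transitivity (\sum_(j | j == i) \sum_(k : 'I_(lam j) | true) 1)%N.
  rewrite (sig_big_dep (fun j => j == i) (fun _ => xpredT) (fun _ _ => 1%N)) /=.
  by apply: eq_bigl => p; rewrite andbT.
by rewrite big_pred1_eq sum1_card card_ord.
Qed.

(* Junk value p when row a has no cell in the column of p. *)
Definition climb a (p : cell lam) : cell lam :=
  if insub (ccol p) is Some j then existT (fun i : I => 'I_(lam i)) a j else p.

Lemma climbP a (p : cell lam) : (a <= crow p)%N ->
  crow (climb a p) = a /\ ccol (climb a p) = ccol p.
Proof.
case: p => i j; rewrite /crow /= => ai; rewrite /climb; case: insubP => [k _ ek|] //=.
have := ltn_ord j; move/forallP/(_ a)/forallP/(_ i): plam; rewrite ai /= => le lt.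
by move/negP => []; rewrite /ccol /=; apply: leq_trans lt le.
Qed.

Definition delta s : F := fun u => (u == s)%:R.

Lemma cf_wvec m s : size s = m -> cf (wvec C m s) = delta (rev s).
Proof.
move=> sm; rewrite -[RHS](@mkK C N m) => [|u um]; last first.
  rewrite /delta; have [e|//] := eqVneq u (rev s).
  by rewrite e size_rev sm eqxx in um.
by congr cf; apply/ffunP => w; rewrite !ffunE /delta (inj_eq (can_inj revK)).
Qed.

Lemma cf_specht t : is_tableau t -> cf (specht_vec C t) =
  \sum_(sg in colstab t) (-1) ^+ sg *: delta (rev (word (tab_act sg t))).
Proof.
move=> tt; rewrite /specht_vec cf_sum; apply: eq_bigr => sg _.
by rewrite cfZ cf_wvec ?size_tuple.
Qed.

Lemma wt_delta s : wt (cont s) (delta s).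
Proof.
apply/wtP => u; rewrite /delta; have [->//|_] := eqVneq u s.
by rewrite eqxx.
Qed.

Lemma Emap_tuple m (f : F) a b (w : m.-tuple I) : Emap a b f w =
  \sum_(k < m | tnth w k == a) f [tuple if j == k then b else tnth w j | j < m].
Proof.
elim: m f w => [|m IH] f w; first by rewrite tuple0 big_ord0.
case/tupleP: w => c w; rewrite [LHS]hd_app hd_E !wfE IH.
rewrite [RHS]big_mkcond big_ord_recl -[X in _ = _ + X]big_mkcond /=.
rewrite tnth0; congr (_ + _).
  case: eqVneq => _; rewrite ?mul1r ?mul0r //; rewrite /hd; congr f.
  rewrite /= enum_ordSl /= -map_comp -[in LHS](map_tnth_enum w); congr cons.
  by apply: eq_map => j /=; rewrite tnthS.
apply: eq_big => [k|k _]; first by rewrite tnthS.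
rewrite /hd; congr f; rewrite [in RHS]/= enum_ordSl /= -map_comp tnth0.
congr cons; apply: eq_map => j /=; rewrite tnthS.
by rewrite (inj_eq lift_inj).
Qed.

(* Exchanging the cells of rows a and b in a column pairs off the terms of the
   image tail_op Emap a b, with opposite signs. *)
Lemma specht_hwv t : is_tableau t -> hwv lam (cf (specht_vec C t)).
Proof.
move=> tt; rewrite cf_specht //; split=> [|a b ab].
  elim/big_rec: _ => [|sg x _ wx]; first exact: wt0.
  apply: wt_linear => //; have := wt_delta (rev (word (tab_act sg t))).
  by rewrite cont_rev cont_word //; apply: tab_act_tableau.
set f := \sum_(_ in _) _.
have df : deg n f.
  apply: deg_sum => sg _; apply: degZ => u un; rewrite /delta.
  have [e|//] := eqVneq u (rev (word (tab_act sg t))).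
  by rewrite e size_rev size_tuple eqxx in un.
apply: wfP => s; have [sn|sn] := eqVneq (size s) n; last exact: (@deg_Emap _ _ _ a b _ df _ sn).
have rs : size (rev s) == n by rewrite size_rev sn.
rewrite -[s]revK -[rev s]/(tval (Tuple rs)) rev_E Emap_tuple; set w := Tuple rs.
pose upd k := [tuple if j == k then b else tnth w j | j < n].
pose A (p : 'S_n * 'I_n) : C := if (p.1 \in colstab t) && (tnth w p.2 == a)
   && (upd p.2 == word (tab_act p.1 t)) then (-1) ^+ p.1 else 0.
have -> : \sum_(k < n | tnth w k == a) f (rev (upd k)) = \sum_p A p.
  rewrite -(pair_bigA _ (fun sg k => A (sg, k))) exchange_big big_mkcond /=.
  apply: eq_bigr => k _; case: ifP => wk; last by rewrite big1 // => sg _; rewrite /A wk andbF.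
  rewrite /f fct_sumE big_mkcond; apply: eq_bigr => sg _; rewrite /A /= wk andbT.
  case: (sg \in colstab t) => //=; rewrite /delta wfE (inj_eq (can_inj revK)).
  by rewrite -[upd k == _]val_eqE; case: (_ == _); rewrite ?mulr1 ?mulr0.
have [u tu ut] := tableau_bij tt.
pose iv (p : 'S_n * 'I_n) : {perm 'I_n} := (p.1^-1)%g.
(* The entry k of the permuted tableau sits in the cell [t (iv p k)]; [l p] is its entry in row a of
   the column containing [p.2]. *)
pose l (p : 'S_n * 'I_n) : 'I_n := p.1 (u (climb a (t (iv p p.2)))).
pose Phi (p : 'S_n * 'I_n) : 'S_n * 'I_n :=
  if crow (t (iv p p.2)) == b then ((p.1 * tperm p.2 (l p))%g, l p) else p.
have inv_act (p : 'S_n * 'I_n) k :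
    ((p.1 * tperm p.2 (l p))^-1)%g k = iv p (tperm p.2 (l p) k).
  by rewrite invMg permM tpermV.
have lP p : crow (t (iv p p.2)) = b ->
    crow (t (iv p (l p))) = a /\ ccol (t (iv p (l p))) = ccol (t (iv p p.2)).
  by move=> e; rewrite /l permK ut; apply: climbP; rewrite e ltnW.
have lne p : crow (t (iv p p.2)) = b -> p.2 != l p.
  move=> e; have [+ _] := lP p e; apply: contra_eq_neq => <-.
  by rewrite e; apply: contraTneq ab => ->; rewrite ltnn.
have PhiK : involutive Phi.
  move=> p; rewrite {2}/Phi; case: ifP => [/eqP e|ne]; last by rewrite /Phi ne.
  rewrite /Phi /= inv_act tpermR e eqxx.
  have -> : l ((p.1 * tperm p.2 (l p))%g, l p) = p.2.
    by rewrite {1}/l /= inv_act tpermR permM -/(l p) tpermR.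
  by rewrite -mulgA (tpermC (l p)) tperm2 mulg1; case: p {e}.
have Aimp p : A p != 0 -> A (Phi p) = - A p.
  rewrite {1 3}/A; case: ifP; last by rewrite eqxx.
  move=> /andP [/andP [sgt /eqP wk] /eqP ew] _.
  have upd_nth j : (if j == p.2 then b else tnth w j) = crow (t (iv p j)).
    by have := congr1 (fun v => tnth v j) ew; rewrite !tnth_mktuple ffunE.
  have e : crow (t (iv p p.2)) = b by rewrite -upd_nth eqxx.
  have [ca cc] := lP p e; have pl := lne p e.
  rewrite /Phi e eqxx /A /=.
  have -> : (p.1 * tperm p.2 (l p))%g \in colstab t.
    move: sgt; rewrite !inE => /forallP sgt; apply/forallP => j; rewrite permM.
    have colE j' : ccol (t j') = ccol (t (iv p j')).
      by have /eqP := sgt (iv p j'); rewrite permKV.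
    rewrite -(eqP (sgt j)); case: tpermP => [->|->|//]; apply/eqP.
      by rewrite colE cc -colE.
    by rewrite [RHS]colE cc -colE.
  have -> : tnth w (l p) == a.
    by have := upd_nth (l p); rewrite eq_sym (negPf pl) ca => ->.
  have -> /= : upd (l p) == word (tab_act (p.1 * tperm p.2 (l p))%g t).
    apply/eqP/eq_from_tnth => j; rewrite !tnth_mktuple ffunE inv_act.
    have [->|jl] := eqVneq j (l p); first by rewrite tpermR e.
    have [->|jk] := eqVneq j p.2; first by rewrite tpermL ca wk.
    by rewrite tpermD 1?eq_sym // -upd_nth (negPf jk).
  by rewrite odd_permM odd_tperm pl signr_addb mulrN1.
have Aopp p : A (Phi p) = - A p.
  have [Ap|/Aimp //] := eqVneq (A p) 0.
  rewrite Ap oppr0; apply/eqP; apply: contraT => nA.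
  by have := Aimp _ nA; rewrite PhiK Ap => /esym/eqP; rewrite oppr_eq0 (negPf nA).
have : \sum_p A p = - \sum_p A p.
  by rewrite {1}(reindex_inj (inv_inj PhiK)) /= -sumrN; apply: eq_bigr => p _; apply: Aopp.
by move=> /eqP; rewrite -addr_eq0 -mulr2n mulrn_eq0 => /eqP.
Qed.

(** The words first differ at the smallest moved entry k. Its new cell was that of a larger entry of
    the same column, and so lies lower, as t is standard. *)
Lemma colstab_key t sg : is_standard t -> sg \in colstab t -> sg != 1%g ->
  (key (rev (word t)) < key (rev (word (tab_act sg t))))%N.
Proof.
move=> /andP [tt /forallP st] sgt sg1.
have [k0 k0P] : exists k, (sg^-1)%g k != k.
  apply/existsP; apply: contraNT sg1; rewrite negb_exists => /forallP fix_sg.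
  apply/eqP/permP => k; rewrite perm1; apply: (@perm_inj _ (sg^-1)%g).
  by rewrite permK; apply/esym/eqP; rewrite -[_ == _]negbK.
have [k kP kmin] := @arg_minnP _ k0 (fun k => (sg^-1)%g k != k) val k0P.
set k' := (sg^-1)%g k in kP *.
have fixlt (j : 'I_n) : (j < k)%N -> (sg^-1)%g j = j.
  by move=> jk; apply/eqP; apply: contraTT jk => nj; rewrite -leqNgt; apply: kmin.
have kk' : (k < k')%N.
  rewrite ltn_neqAle eq_sym (inj_eq val_inj) kP leqNgt; apply/negP => k'k.
  by move: kP; rewrite -(inj_eq (@perm_inj _ (sg^-1)%g)) fixlt // eqxx.
have ccE : ccol (t k) = ccol (t k').
  by move: sgt; rewrite inE => /forallP /(_ k') /eqP <-; rewrite permKV.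
have rlt : (crow (t k) < crow (t k'))%N.
  rewrite ltnNge leq_eqVlt; apply/negP => /orP [/eqP/val_inj e|lt].
    have := cell_eq e (esym ccE) => /(injectiveP _ tt) ek.
    by move: kk'; rewrite ek ltnn.
  have := st k' => /forallP /(_ k) /implyP; rewrite ccE eqxx lt orbT => /(_ isT).
  by rewrite ltnNge ltnW.
have split_at (x : n.-tuple I) : rev x = rev (drop k.+1 x) ++ tnth x k :: rev (take k x).
  rewrite -{1}(cat_take_drop k x) (drop_nth (tnth x k)) ?size_tuple // rev_cat rev_cons.
  by rewrite cat_rcons -(tnth_nth (tnth x k)).
rewrite (split_at (word t)) (split_at (word _)).
have -> : take k (word t) = take k (word (tab_act sg t)).
  apply: (@eq_from_nth _ (tnth (word t) k)).
    by rewrite !size_take !size_tuple.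
  move=> j; rewrite size_take size_tuple ltn_ord => ik; rewrite !nth_take //.
  have lin : (j < n)%N by apply: ltn_trans (ltn_ord k).
  rewrite -[j]/(val (Ordinal lin)) -(tnth_nth _ (word t)) -(tnth_nth _ (word (tab_act sg t))).
  by rewrite !tnth_mktuple ffunE fixlt.
apply: key_lt; first by rewrite !size_rev !size_drop !size_tuple.
by rewrite !tnth_mktuple ffunE.
Qed.

Lemma specht_leading t s : is_standard t ->
  (s == rev (word t)) || (key s <= key (rev (word t)))%N ->
  cf (specht_vec C t) s = (s == rev (word t))%:R.
Proof.
move=> st sle; have /andP [tt _] := st; rewrite cf_specht // fct_sumE.
have one_t : 1%g \in colstab t by rewrite inE; apply/forallP => k; rewrite perm1.
have word1 : word (tab_act 1%g t) = word t.
  by apply: eq_from_tnth => k; rewrite !tnth_mktuple ffunE invg1 perm1.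
rewrite (bigD1 1%g) // wfE odd_perm1 expr0 mul1r word1 big1 => [|sg /andP [sgt sg1]]; first exact: addr0.
rewrite wfE /delta; have [e|_] := eqVneq s _; last by rewrite mulr0.
have := colstab_key st sgt sg1; rewrite -e.
move: sle; have [->|_] := eqVneq s (rev (word t)); first by rewrite ltnn.
by rewrite /= leqNgt => /negPf ->.
Qed.

(** Entry k goes to the row given by its letter, in the column counting the earlier occurrences of
    this letter; the lattice condition makes the columns increase. *)
Lemma lattice_tableau s : lattice s -> cont s = lam ->
  exists2 t : tableau lam, is_standard t & rev (word t) = s.
Proof.
move=> ls cs; have sn : size (rev s) == n by rewrite size_rev -cs psize_cont.
have [w ws] : exists w : n.-tuple I, w = rev s :> seq I by exists (Tuple sn).
have cw i : count_mem i w = lam i.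
  by have := congr1 (fun mu : rowshape N => mu i) cs; rewrite ws count_rev ffunE.
pose cnt a (j : nat) := count_mem a (take j w).
have cntS (k : 'I_n) a : cnt a k.+1 = (cnt a k + (tnth w k == a))%N.
  rewrite /cnt (take_nth (tnth w k)) ?size_tuple // -cats1 count_cat /= addn0.
  by rewrite -tnth_nth.
have cnt_mono a (i j : nat) : (i <= j)%N -> (cnt a i <= cnt a j)%N.
  by move=> ij; rewrite /cnt -(subnKC ij) takeD count_cat leq_addr.
have cnt_lam a : cnt a n = lam a by rewrite /cnt take_oversize ?cw // size_tuple.
pose pos (k : 'I_n) := cnt (tnth w k) k.
have rowlt k l : tnth w k = tnth w l -> (k < l)%N -> (pos k < pos l)%N.
  by move=> e kl; have := cnt_mono (tnth w k) _ _ kl; rewrite cntS eqxx /pos -e addn1.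
have pos_lt k : (pos k < lam (tnth w k))%N.
  by have := cnt_mono (tnth w k) _ _ (ltn_ord k); rewrite cntS eqxx addn1 cnt_lam.
pose t : tableau lam := [ffun k => existT (fun i : I => 'I_(lam i)) (tnth w k) (Ordinal (pos_lt k))].
have tr k : crow (t k) = tnth w k by rewrite ffunE.
have tc k : ccol (t k) = pos k by rewrite ffunE.
exists t; last first.
  rewrite -[s]revK -ws; congr rev; apply: (congr1 val (_ : word t = w)).
  by apply: eq_from_tnth => k; rewrite tnth_mktuple tr.
apply/andP; split.
  apply/injectiveP => k l e; apply: val_inj; have er := congr1 (@crow N lam) e.
  have ec := congr1 (@ccol N lam) e; rewrite !tr !tc in er ec.
  by have [lt|lt|//] := ltngtP k l; [have := rowlt _ _ er lt | have := rowlt _ _ (esym er) lt];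
    rewrite ec ltnn.
apply/forallP => k; apply/forallP => l; rewrite !tr !tc; apply/implyP => /orP [] /andP [/eqP e lt].
  rewrite ltnNge; apply/negP => lk; have := cnt_mono (tnth w k) _ _ lk.
  by move: lt; rewrite /pos e ltnNge => /negPf ->.
rewrite ltnNge leq_eqVlt; apply/negP => /orP [/eqP/val_inj lk|lk].
  by move: lt; rewrite lk ltnn.
have lat : is_partition (cont (take l.+1 w)).
  by rewrite ws take_rev cont_rev; apply: lattice_partition; apply: lattice_drop.
have := forallP lat (tnth w k) => /forallP /(_ (tnth w l)) /implyP /(_ (ltnW lt)).
have := cntS l (tnth w l); rewrite eqxx addn1 => cl.
rewrite !ffunE -!/(cnt _ _) cl => /leq_trans /(_ (cnt_mono (tnth w k) _ _ lk)).
by move: e; rewrite /pos => ->; rewrite ltnn.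
Qed.

(* By specht_leading, the Specht vectors are unitriangular on lattice words. *)
Lemma specht_lattice_surj (g : F) : exists2 x, x \in Specht C lam &
  forall s, lattice s -> cont s = lam -> cf x s = g s.
Proof.
have [y yS yP] : exists2 y : seq I -> wspace C N n, forall s, y s \in Specht C lam &
    forall s, lattice s -> cont s = lam ->
    forall u, (u == s) || (key u <= key s)%N -> cf (y s) u = (u == s)%:R.
  suff /choice [y yP] : forall s, exists x, x \in Specht C lam /\ (lattice s -> cont s = lam ->
      forall u, (u == s) || (key u <= key s)%N -> cf x u = (u == s)%:R).
    by exists y => s; [have [] := yP s | have [_] := yP s].
  move=> s; have [[ls cs]|no] := pselect (lattice s /\ cont s = lam); last first.
    by exists 0; split=> [|ls cs]; [apply: mem0v | case: no].
  have [t st wt] := lattice_tableau ls cs; exists (specht_vec C t); split=> [|_ _ u us].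
    by apply: memv_span; apply/mapP; exists t; rewrite // mem_enum.
  by rewrite specht_leading ?wt.
pose K := (N ^ n)%N.
have keyK s : cont s = lam -> (key s < K)%N.
  by move=> cs; have := key_bound s; rewrite /K -cs psize_cont.
(* Induction on how far below K the keys of the support of g reach: [x0] agrees with g at the lowest
   key and is 0 at smaller ones, so subtracting it raises the lowest key. *)
have gen (r : nat) : forall g : F, (forall s, lattice s -> cont s = lam -> g s != 0 -> (K <= key s + r)%N) ->
    exists2 x, x \in Specht C lam & forall s, lattice s -> cont s = lam -> cf x s = g s.
  elim: r => [|r IH] {}g gd.
    exists 0; first exact: mem0v.
    move=> s ls cs; rewrite cf0; apply/esym/eqP; apply: contraT => /(gd s ls cs).
    by rewrite addn0 leqNgt keyK.
  pose good (w : n.-tuple I) := [&& lattice w, cont w == lam & (key w + r.+1 == K)%N].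
  pose x0 := \sum_(w : n.-tuple I | good w) (g w : C) *: y w.
  have x0S : x0 \in Specht C lam by apply: memv_suml => w _; apply: memvZ.
  have cfx0 s : lattice s -> cont s = lam -> (key s + r.+1 <= K)%N ->
      cf x0 s = if (key s + r.+1 == K)%N then g s else 0.
    move=> ls cs sK; rewrite cf_sum fct_sumE.
    have [eK|nK] := ifPn.
      have sn : size s == n by rewrite -cs psize_cont.
      have gs : good (Tuple sn) by rewrite /good /= ls cs eqxx eK.
      rewrite (bigD1 (Tuple sn)) //= cfZ wfE yP ?eqxx //= mulr1 big1 ?addr0 // => w /andP [gw ws].
      have /and3P [lw /eqP cw /eqP kw] := gw; rewrite cfZ wfE yP //.
        rewrite (_ : (s == w) = false) ?mulr0 //; apply: contra_neqF ws => /eqP e.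
        exact: val_inj.
      by apply/orP; right; move/eqP: eK; lia.
    apply: big1 => w /and3P [lw /eqP cw /eqP kw]; rewrite cfZ wfE yP //.
      rewrite (_ : (s == w) = false) ?mulr0 //; apply: contraNF nK => /eqP ->.
      by rewrite kw.
    by apply/orP; right; lia.
  have [|x1 x1S x1P] := IH (g - cf x0).
    move=> s ls cs; apply: contraR; rewrite -ltnNge => lt.
    have le : (key s + r.+1 <= K)%N by rewrite addnS.
    rewrite !wfE cfx0 //; case: ifPn => [_|ne]; first by rewrite subrr.
    rewrite subr0; apply: contraT => /(gd s ls cs) ge.
    by move: ne; rewrite eqn_leq le ge.
  exists (x1 + x0); first exact: memvD.
  by move=> s ls cs; rewrite cfD wfE x1P // !wfE subrK.
by apply: (gen K) => s _ _ _; apply: leq_addl.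
Qed.

Lemma specht_sub x : x \in Specht C lam -> hwv lam (cf x).
Proof.
have [||W WP] := @vspace_of_pred C (wspace C N n) (fun x => hwv lam (cf x)).
- by rewrite cf0; apply: hwv0.
- by move=> k u v hu hv; rewrite cfD cfZ; apply: hwv_linear.
rewrite -WP; apply: subvP; apply/span_subvP => _ /mapP [t + ->].
by rewrite mem_enum => /andP [tt _]; apply/WP; apply: specht_hwv.
Qed.

(** A highest weight vector is determined by its values at lattice words, and Specht vectors already
    take all possible values there. *)
Lemma spechtP x : x \in Specht C lam <-> hwv lam (cf x).
Proof.
split=> [|hx]; first exact: specht_sub.
have [y yS yP] := specht_lattice_surj (cf x).
suff e : cf (x - y) = 0.
  have : x - y = 0 by apply: cf_inj; rewrite e cf0.
  by move=> /eqP; rewrite subr_eq0 => /eqP ->.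
have hxy : hwv lam (cf (x - y)) by rewrite cfD cfN; apply: hwvB => //; apply: specht_sub.
apply: (lattice_inj hxy) => s ls; apply/eqP; apply: contraT => nz.
have cs : cont s = lam by have [/wtP wxy _] := hxy; apply: wxy.
by move: nz; rewrite cfD cfN !wfE yP // subrr eqxx.
Qed.

(* Some highest weight vector h of weight kap + e_b has y as its component at
   the words ending with b, so that <pre b y, h> = <y, y>. *)
Lemma hwproj_pre_neq0 kap b (y : F) : hwv kap y -> y <> 0 -> lam = addcell kap b ->
  hwproj lam (pre b y) <> 0.
Proof.
move=> hy y0 lamE P0; have pk := hwv_partition hy y0.
pose g : F := fun s => if s is c :: s' then if c == b then y s' else 0 else 0.
have [h0 /specht_sub hh0 h0P] := specht_lattice_surj g; set h := cf h0 in hh0 h0P.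
have [wh rh] := hh0.
have hdE (a c d : I) : (c < d)%N -> Emap c d (hd a h) = - ((a == c)%:R *: hd d h).
  by move=> cd; rewrite Emap_hd rh // hd0 sub0r.
have cont_hd a s : hd a h s != 0 -> addcell (cont s) a = lam.
  by rewrite -cont_cons => hs; move/wtP: wh; apply.
have hd_lat a s : lattice s -> hd a h s != 0 -> h (a :: s) = g (a :: s).
  move=> ls hs; have e := cont_hd _ _ hs; apply: h0P; last by rewrite cont_cons.
  by rewrite /= ls cont_cons e.
(* For the largest c > b with a nonzero slice, this slice would be a highest weight vector; by the
   choice of g it vanishes on lattice words. *)
have big0 a : (b < a)%N -> hd a h = 0.
  move=> ba; apply: contrapT => /eqP ha.
  have [c /andP [bc hc] cmax] :=
    @arg_maxnP _ a (fun c : I => (b < c)%N && (hd c h != 0)) val (introT andP (conj ba ha)).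
  have [s hs] := wf_neq0 (elimN eqP hc).
  move/eqP: hc; apply; apply: (@lattice_inj C N (cont s)); last first.
    move=> s' ls'; apply/eqP; apply: contraT => hs'.
    have := hd_lat _ _ ls' hs'; rewrite /g; have [cb|_] := eqVneq c b.
      by move: bc; rewrite cb ltnn.
    by rewrite hd_app => e; rewrite e eqxx in hs'.
  split=> [|i j ij]; first by apply: wt_hd; rewrite (cont_hd _ _ hs).
  rewrite hdE //; have [ci|_] := eqVneq c i; last by rewrite scale0r oppr0.
  rewrite scale1r; apply/eqP; rewrite oppr_eq0; apply: contraTT ij => hj.
  rewrite -leqNgt -ci; have [bj|jb] := ltnP b j; first by apply: cmax; rewrite bj.
  by apply: leq_trans jb _; apply: ltnW.
have hb : hwv kap (hd b h).
  split=> [|c d cd]; first by apply: wt_hd; rewrite -lamE.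
  rewrite hdE //; have [bc|_] := eqVneq b c; last by rewrite scale0r oppr0.
  by rewrite scale1r big0 ?oppr0 // bc.
have hby : hd b h = y.
  apply/eqP; rewrite -subr_eq0; apply/eqP; have hd0 := hwvB hb hy.
  apply: (lattice_inj hd0) => s ls; apply/eqP; apply: contraT => nz.
  have cs : cont s = kap by have [/wtP wd _] := hd0; apply: wd.
  have cbs : cont (b :: s) = lam by rewrite cont_cons cs lamE.
  move: nz; rewrite !wfE -hd_app h0P ?cbs //; last by rewrite /= ls cbs.
  by rewrite /g eqxx subrr eqxx.
have := dot_hwproj (pre b y) hh0; rewrite P0 dot0l {1}lamE psize_addcell dot_pre hby.
by move=> /esym /(dot_eq0 (hwv_deg hy)).
Qed.

End Tableaux.

(** * Lifting along horizontal strips is injective *)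

Section Positivity.
Variables (C : numClosedFieldType) (N : nat).
Local Notation I := 'I_N.
Local Notation F := (seq 'I_N -> C^o).
Implicit Types (f g h v x y z : F) (s t : seq I) (a b c d k : I) (m n : nat)
  (lam mu kap : rowshape N).

Lemma hd_sum_pre d (G : I -> F) : hd d (\sum_c pre c (G c)) = G d.
Proof.
rewrite hd_sum (bigD1 d) //= hd_pre eqxx scale1r big1 ?addr0 // => c /negPf cd.
by rewrite hd_pre eq_sym cd scale0r.
Qed.

Lemma sum_pre_nil (G : I -> F) : (\sum_c pre c (G c)) [::] = 0.
Proof. by rewrite fct_sumE big1. Qed.

(* M^(m+1) is the tensor product of the natural module (the first letter of a
   reversed word) with M^(m).  Omega is the Casimir operator of this tensor
   product; insert is top-to-random and its adjoint extract is random-to-top;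
   tail_op P applies P to the second factor; swap exchanges two letters. *)
Definition Omega f : F := \sum_d pre d (\sum_c Emap c d (hd c f)).
Definition insert f : F := \sum_c shf c (hd c f).
Definition extract f : F := \sum_d pre d (delf d f).
Definition tail_op (P : F -> F) f : F := \sum_c pre c (P (hd c f)).
Definition swap f : F := fun s => if s is c :: d :: s' then f (d :: c :: s') else f s.

Lemma Omega_nil f : Omega f [::] = (0 : C). Proof. exact: sum_pre_nil. Qed.
Lemma extract_nil f : extract f [::] = (0 : C). Proof. exact: sum_pre_nil. Qed.
Lemma tail_op_nil P f : tail_op P f [::] = (0 : C). Proof. exact: sum_pre_nil. Qed.
Definition op_nil := (Omega_nil, extract_nil, tail_op_nil).

Lemma hd_Omega d f : hd d (Omega f) = \sum_c Emap c d (hd c f).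
Proof. exact: hd_sum_pre. Qed.
Lemma hd_extract d f : hd d (extract f) = delf d f.
Proof. exact: hd_sum_pre. Qed.
Lemma hd_tail_op P d f : hd d (tail_op P f) = P (hd d f).
Proof. exact: hd_sum_pre. Qed.

Lemma Omega_linear : linear Omega.
Proof.
move=> k f g; apply: wfP_hd => [|d]; first by rewrite !wfE !op_nil mulr0 addr0.
rewrite hdD hdZ !hd_Omega scaler_sumr -big_split; apply: eq_bigr => c _.
by rewrite hdD hdZ EmapD EmapZ.
Qed.
Lemma extract_linear : linear extract.
Proof.
move=> k f g; apply: wfP_hd => [|d]; first by rewrite !wfE !op_nil mulr0 addr0.
by rewrite hdD hdZ !hd_extract delfD delfZ.
Qed.
Lemma insert_linear : linear insert.
Proof.
move=> k f g; rewrite /insert scaler_sumr -big_split; apply: eq_bigr => c _.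
by rewrite hdD hdZ shfD shfZ.
Qed.
Lemma tail_op_linear P : linear P -> linear (tail_op P).
Proof.
move=> lP k f g; apply: wfP_hd => [|d]; first by rewrite !wfE !op_nil mulr0 addr0.
by rewrite hdD hdZ !hd_tail_op hdD hdZ lP.
Qed.

Lemma E_Omega a b f : Emap a b (Omega f) = Omega (Emap a b f).
Proof.
apply: wfP_hd => [|d]; first by rewrite E_nil op_nil.
rewrite hd_E !hd_Omega Emap_sum.
rewrite [X in _ + X = _](eq_bigr (fun c => Emap c d (Emap a b (hd c f)) + (b == c)%:R *: Emap a d (hd c f) -
  (a == d)%:R *: Emap c b (hd c f))); last by move=> c _; apply: E_comm.
rewrite [RHS](eq_bigr (fun c => (c == a)%:R *: Emap c d (hd b f) + Emap c d (Emap a b (hd c f)))); last first.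
  by move=> c _; rewrite hd_E EmapD EmapZ.
rewrite sumrB !big_split /= -scaler_sumr [d == a]eq_sym.
rewrite [LHS]addrC subrK [RHS]addrC; congr (_ + _).
rewrite (bigD1 b) //= eqxx scale1r big1 ?addr0 => [|c /negPf cb]; last by rewrite eq_sym cb scale0r.
rewrite (bigD1 a) //= eqxx scale1r big1 ?addr0 // => c /negPf ca.
by rewrite ca scale0r.
Qed.

Lemma E_insert a b f : Emap a b (insert f) = insert (Emap a b f).
Proof.
rewrite /insert Emap_sum.
rewrite (eq_bigr (fun c => shf c (Emap a b (hd c f)) + (b == c)%:R *: shf a (hd c f))); last first.
  by move=> c _; rewrite E_sh.
rewrite [RHS](eq_bigr (fun c => shf c (Emap a b (hd c f)) + (c == a)%:R *: shf c (hd b f))); last first.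
  by move=> c _; rewrite hd_E shfD shfZ addrC.
rewrite !big_split /=; congr (_ + _).
rewrite (bigD1 b) //= eqxx scale1r big1 ?addr0 => [|c /negPf cb]; last by rewrite eq_sym cb scale0r.
rewrite (bigD1 a) //= eqxx scale1r big1 ?addr0 // => c /negPf ca.
by rewrite ca scale0r.
Qed.

Lemma E_extract a b f : Emap a b (extract f) = extract (Emap a b f).
Proof.
apply: wfP_hd => [|d]; first by rewrite E_nil op_nil.
by rewrite hd_E !hd_extract E_de [d == a]eq_sym addrC subrK.
Qed.

Lemma Omega_intertwines m : intertwines m Omega Omega.
Proof.
split; [exact: E_Omega | exact: E_Omega | exact: Omega_linear | exact: Omega_linear | move=> f g].
case: m => [|m]; first by rewrite !dot_nil !op_nil mul0r conjC0 mulr0.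
rewrite !dotS; transitivity (\sum_d \sum_c dot m (Emap c d (hd c f)) (hd d g)).
  by apply: eq_bigr => d _; rewrite hd_Omega dot_suml.
rewrite exchange_big; apply: eq_bigr => c _; rewrite hd_Omega dot_sumr.
by apply: eq_bigr => d _; rewrite dot_Emap.
Qed.

Lemma dot_extract_insert m f g : dot m (extract f) g = dot m f (insert g).
Proof.
case: m => [|m].
  by rewrite !dot_nil op_nil mul0r /insert fct_sumE big1 ?conjC0 ?mulr0.
by rewrite dotS dot_sumr; apply: eq_bigr => d _; rewrite hd_extract dot_de.
Qed.

Lemma insert_intertwines m : intertwines m insert extract.
Proof.
split; [exact: E_insert | exact: E_extract | exact: insert_linear | exact: extract_linear | move=> f g].
by rewrite dotC -dot_extract_insert -dotC.
Qed.

Lemma extract_intertwines m : intertwines m extract insert.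
Proof.
split; [exact: E_extract | exact: E_insert | exact: extract_linear | exact: insert_linear |].
exact: dot_extract_insert.
Qed.

Lemma tail_op_intertwines m P Q : intertwines m P Q -> intertwines m.+1 (tail_op P) (tail_op Q).
Proof.
have comm (R : F -> F) : linear R -> (forall a b f, Emap a b (R f) = R (Emap a b f)) ->
    forall a b f, Emap a b (tail_op R f) = tail_op R (Emap a b f).
  move=> lR cR a b f; apply: wfP_hd => [|d]; first by rewrite E_nil op_nil.
  by rewrite hd_E !hd_tail_op hd_E cR lR.
case=> cP cQ lP lQ adj; split; [exact: comm | exact: comm | exact: tail_op_linear
  | exact: tail_op_linear | move=> f g].
by rewrite !dotS; apply: eq_bigr => d _; rewrite !hd_tail_op adj.
Qed.

(** The count of [hwproj_sum_sh] again: the Casimir operator acts by the content of the added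
    cell. *)
Lemma Omega_hwproj lam kap b y : hwv kap y ->
  Omega (hwproj lam (pre b y)) = ((kap b)%:R - b%:R) *: hwproj lam (pre b y).
Proof.
move=> [wy ry]; rewrite -(hwproj_commute _ (Omega_intertwines _)).
have -> : Omega (pre b y) = \sum_d pre d (Emap b d y).
  apply: eq_bigr => d _; congr pre; rewrite (bigD1 b) //= hd_pre eqxx scale1r big1 ?addr0 //.
  by move=> c /negPf cb; rewrite hd_pre cb scale0r Emap0.
rewrite linear_sum (bigID (fun d => (d < b)%N)) /=.
rewrite (eq_bigr (fun=> - hwproj lam (pre b y))); last first.
  move=> d db; have /(congr1 (fun u : F => hwproj lam (u - pre b y))) := E_pre b d d y.
  by rewrite eqxx scale1r addrAC subrr add0r => <-; rewrite linearB /= hwproj_lower // sub0r.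
rewrite [X in _ + X](bigD1 b) ?ltnn //= wy preZ linearZ /= [X in _ + (_ + X)]big1 ?addr0; last first.
  move=> d; rewrite -leqNgt leq_eqVlt -(inj_eq val_inj) [val d == _]eq_sym => /andP [/orP [->//|bd] _].
  by rewrite ry // pre0 linear0.
rewrite addrC scalerBl; congr (_ + _).
rewrite -count_below scaler_suml -sumrN; apply: eq_bigr => d _.
by rewrite scale1r.
Qed.

Lemma dot_eigen m (P : F -> F) f g (p q : C) : (forall f g, dot m (P f) g = dot m f (P g)) ->
  P f = p *: f -> P g = q *: g -> q \is Num.real -> p != q -> dot m f g = 0.
Proof.
move=> adj pf qg rq pq; have := adj f g; rewrite pf qg dotZl dotZr (CrealP rq) => /eqP.
by rewrite -subr_eq0 -mulrBl mulf_eq0 subr_eq0 (negPf pq) => /eqP.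
Qed.

Definition delcell kap k : rowshape N := [ffun i => kap i - (i == k)]%N.

Lemma addcellK kap k : delcell (addcell kap k) k = kap.
Proof. by apply/ffunP => i; rewrite !ffunE addnK. Qed.

(** A nonzero remainder q orthogonal to all such projections has a nonzero highest weight slice v by
    [hwv_last_letter], and pairing q with the projection of [pre a v] gives the squared norm of v.
    The disjunction discards the rows with kap_k = 0, where [delcell] changes nothing. *)
Lemma hwv_decompose kap w : hwv kap w -> (0 < psize kap)%N -> exists v : I -> F,
  (forall k, (v k = 0 \/ kap = addcell (delcell kap k) k) /\ hwv (delcell kap k) (v k)) /\
  w = \sum_k hwproj kap (pre k (v k)).
Proof.
move=> hw kap0.
pose good k v := (v = 0 \/ kap = addcell (delcell kap k) k) /\ hwv (delcell kap k) v.
pose U f := exists2 v : I -> F, forall k, good k (v k) & f = \sum_k hwproj kap (pre k (v k)).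
have [||| _ [v gv ->] pP] := @orthogonal_split_pred C N (psize kap) U w.
- exists (fun=> 0); first by move=> k; split; [left | apply: hwv0].
  by rewrite big1 // => k _; rewrite pre0 linear0.
- move=> r f g [v1 g1 ->] [v2 g2 ->]; exists (fun k => r *: v1 k + v2 k).
    move=> k; have [o1 h1] := g1 k; have [o2 h2] := g2 k; split; last exact: hwv_linear.
    by case: o1 => [->|]; [case: o2 => [->|]; [left; rewrite scaler0 addr0 | right] | right].
  by rewrite scaler_sumr -big_split; apply: eq_bigr => k _; rewrite preD preZ linearD linearZ.
- move=> f [v gv ->]; apply: (@hwv_deg _ _ kap); apply: hwv_sum => k _; exact: hwproj_hwv.
exists v; split=> //; set p := \sum_k _ in pP *.
have hp : hwv kap p by apply: hwv_sum => k _; apply: hwproj_hwv.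
have hq := hwvB hw hp; apply/eqP; rewrite -subr_eq0; apply/eqP; apply: contrapT => q0.
have qn : (w - p) [::] = 0 by apply: (hwv_deg hq); rewrite /= neq_ltn kap0.
have [a [kap' [kapE hv v0]]] := hwv_last_letter hq qn q0; apply: v0.
set va := hd a (w - p) in hv *; have e : delcell kap a = kap' by rewrite kapE addcellK.
have Up : U (hwproj kap (pre a va)).
  exists (fun k => if k == a then va else 0).
    move=> k; have [->|_] := eqVneq k a; last by split; [left | apply: hwv0].
    by split; [right; rewrite e | rewrite e].
  rewrite (bigD1 a) //= eqxx big1 ?addr0 // => k /negPf ->.
  by rewrite pre0 linear0.
have := pP _ Up; rewrite dot_hwprojr // {1}kapE psize_addcell -dot_hd -/va.
exact: dot_eq0 (hwv_deg hv).
Qed.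

(* swap exchanges the two Casimir operators up to a translation (the degenerate
   affine Hecke relation), which makes <u_j, swap u_k> explicit on eigenvectors. *)
Lemma tail_op_Omega_swap m f : deg m.+2 f -> deg m.+2 (Omega f) ->
  tail_op Omega (swap f) = swap (Omega f) - f.
Proof.
move=> df dOf; apply: wfP => -[|c [|d s]].
- by rewrite tail_op_nil !wfE /swap df // dOf // subr0.
- by rewrite hd_app hd_tail_op Omega_nil !wfE /swap df // dOf // subr0.
have -> : tail_op Omega (swap f) (c :: d :: s) = (\sum_e Emap e d (hd c (hd e f))) s.
  by rewrite [LHS]hd_app hd_tail_op [LHS]hd_app hd_Omega.
rewrite !wfE; have -> : swap (Omega f) (c :: d :: s) = hd c (hd d (Omega f)) s by [].
rewrite hd_Omega hd_sum [in RHS](eq_bigr (fun e => (c == e)%:R *: hd d (hd e f) +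
  Emap e d (hd c (hd e f)))); last by move=> e _; rewrite hd_E.
have -> : \sum_e ((c == e)%:R *: hd d (hd e f) + Emap e d (hd c (hd e f))) =
    hd d (hd c f) + \sum_e Emap e d (hd c (hd e f)).
  rewrite big_split /=; congr (_ + _).
  rewrite (bigD1 c) //= eqxx scale1r big1 ?addr0 // => e /negPf ec.
  by rewrite eq_sym ec scale0r.
by rewrite wfE addrAC -[X in X - _]/(f (c :: d :: s)) subrr add0r.
Qed.

(** The relation gives (p - q) <u, swap v> = <u, v>, which is a squared norm if u = v and 0 if the
    eigenvalues q and q' differ. *)
Lemma dot_swap m u v (p q q' : C) : deg m.+2 u -> deg m.+2 v ->
  Omega v = p *: v -> tail_op Omega u = q *: u -> tail_op Omega v = q' *: v ->
  p \is Num.real -> q \is Num.real -> q' \is Num.real -> q < p -> 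
  (u = v \/ q <> q') -> 0 <= dot m.+2 u (swap v).
Proof.
move=> du dv ov ou ov' rp rq rq' qp uv.
have [_ _ _ _ adj] := tail_op_intertwines (Omega_intertwines m.+1).
have dov : deg m.+2 (Omega v) by rewrite ov; apply: degZ.
have := adj u (swap v); rewrite (tail_op_Omega_swap dv dov) ou ov.
have swapZ (r : C) : swap (r *: v) = r *: swap v by apply: wfP => -[|c [|d s]].
rewrite swapZ !dotE (CrealP rp) => /eqP; rewrite eq_sym -subr_eq0 addrAC subr_eq0 -mulrBl => /eqP e.
have pq : 0 < p - q by rewrite subr_gt0.
rewrite -(pmulr_rge0 _ pq) e; case: uv => [->|/eqP qq]; first exact: dot_ge0.
by rewrite (dot_eigen adj ou ov' rq' qq).
Qed.

Lemma partition_content kap (i j : I) : is_partition kap -> (i < j)%N ->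
  (kap j)%:R - j%:R < (kap i)%:R - i%:R :> C.
Proof.
move=> /forallP /(_ i) /forallP /(_ j) /implyP pk ij.
by rewrite ler_ltD ?ltrN2 ?ltr_nat ?ler_nat ?(pk (ltnW ij)).
Qed.

(** The vector in question is [insert z], with z the projection of [pre b y]. Its squared norm is (m
    + 1 + al) <z, z> plus a term which decomposes over the removable cells of kap; the assumption on
    deletions discards the rows above b, whose sign would be wrong. *)
Lemma hwproj_sh_neq0 kap b y : hwv kap y -> y <> 0 -> is_partition (addcell kap b) ->
  (forall k kap' v, (k < b)%N -> kap = addcell kap' k -> hwv kap' v ->
     dot (psize kap') (delf k y) v = 0) ->
  hwproj (addcell kap b) (shf b y) <> 0.
Proof.
move=> hy y0 plam orth; set lam := addcell kap b; have pkap := hwv_partition hy y0.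
pose z := hwproj lam (pre b y); have z0 : z <> 0 := hwproj_pre_neq0 plam hy y0 erefl.
have hz : hwv lam z by apply: hwproj_hwv.
have lamS : psize lam = (psize kap).+1 by rewrite psize_addcell.
have -> : shf b y = insert (pre b y).
  rewrite /insert (bigD1 b) //= hd_pre eqxx scale1r big1 ?addr0 // => c /negPf cb.
  by rewrite hd_pre cb scale0r shf0.
rewrite (hwproj_commute _ (insert_intertwines _)) -/z => insert0.
set m := psize kap in lamS *; pose al : C := (kap b)%:R - b%:R.
have Oz : Omega z = al *: z by apply: Omega_hwproj hy.
have dz : deg m.+1 z by rewrite -lamS; apply: hwv_deg.
(* Each of the b rows above row b has a cell in kap, because adding a cell to row b gives a
   partition. This makes m + 1 + al positive. *)
have bm : (b <= m)%N.
  have -> : (b : nat) = (\sum_(i < N | (i < b)%N) 1)%N.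
    by rewrite -(big_ord_widen N (fun=> 1%N) (ltnW (ltn_ord b))) sum1_card card_ord.
  rewrite /m /psize big_mkcond; apply: leq_sum => i _; case: ifP => // ib.
  have /forallP /(_ i) /forallP /(_ b) /implyP := plam; rewrite !ffunE eqxx.
  have -> : (i == b) = false by apply: contraTF ib => /eqP ->; rewrite ltnn.
  by rewrite addn0 addn1 => /(_ (ltnW ib)); apply: leq_ltn_trans.
pose third := \sum_d \sum_c dot m (shf c (delf d (hd c z))) (hd d z).
(* By [de_sh], extraction after insertion yields the Casimir operator, the scalar m + 1 and the
   operators in the opposite order. *)
have norm : dot m.+1 (insert z) (insert z) = (m.+1%:R + al) * dot m.+1 z z + third.
  rewrite -dot_extract_insert dotS (eq_bigr (fun d => dot m (hd d (Omega z)) (hd d z) +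
    m.+1%:R * dot m (hd d z) (hd d z) + \sum_c dot m (shf c (delf d (hd c z))) (hd d z))).
    rewrite !big_split /= -dotS -mulr_sumr -dotS Oz dotZl [in RHS]mulrDl.
    by rewrite [X in _ = X + _]addrC.
  move=> d _; rewrite hd_extract /insert delf_sum hd_Omega !dot_suml.
  rewrite (eq_bigr (fun c => dot m (shf c (delf d (hd c z))) (hd d z) +
    dot m (Emap c d (hd c z)) (hd d z) + (c == d)%:R * (m.+1%:R * dot m (hd c z) (hd d z)))).
    rewrite !big_split /= [X in _ + X](bigD1 d) //= eqxx mul1r [X in _ + (_ + X)]big1 ?addr0.
      by rewrite -addrA addrC.
    by move=> c /negPf ->; rewrite mul0r.
  by move=> c _; rewrite de_sh (deg1E (@deg_hd _ _ _ c _ dz)) !dotE.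
suff third0 : 0 <= third.
  have : 0 < dot m.+1 (insert z) (insert z).
    rewrite norm ltr_wpDr // mulr_gt0 //; last by apply: dot_gt0 => //; apply/eqP.
    rewrite /al addrA -natrD subr_gt0 ltr_nat; move: bm; lia.
  by rewrite insert0 dot0l ltxx.
have [m0|m_gt0] := posnP m.
  rewrite /third m0; apply: sumr_ge0 => d _; apply: sumr_ge0 => c _.
  by rewrite dot_nil sh_nil mul0r.
have hw : hwv kap (extract y).
  by apply: hwv_commute => //; [apply: extract_linear | apply: E_extract].
have [v [vP extE]] := hwv_decompose hw m_gt0.
pose yk k := hwproj kap (pre k (v k)).
pose ga k : C := (delcell kap k k)%:R - k%:R.
have Oyk k : Omega (yk k) = ga k *: yk k by apply: Omega_hwproj; case: (vP k).
have rga k : ga k \is Num.real by rewrite rpredB ?rpred_nat.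
have gaE k : yk k <> 0 -> ga k = (kap k)%:R - k%:R - 1.
  move=> yk0; case: (vP k) => [[v0|e] _].
    by case: yk0; rewrite /yk v0 pre0 linear0.
  have -> : (kap k)%:R = (delcell kap k k)%:R + 1 :> C.
    by rewrite {1}e ffunE eqxx natrD.
  by rewrite /ga; ring.
have gaN k k' : k != k' -> yk k <> 0 -> yk k' <> 0 -> ga k <> ga k'.
  move=> kk' n1 n2; rewrite !gaE // => /addIr e.
  have [lt|lt|/val_inj eqk] := ltngtP k k'; last by rewrite eqk eqxx in kk'.
    by have := partition_content pkap lt; rewrite e ltxx.
  by have := partition_content pkap lt; rewrite e ltxx.
have hyk k : hwv kap (yk k) by apply: hwproj_hwv.
have yk_orth k k' : k != k' -> dot m (yk k) (yk k') = 0.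
  move=> kk'; have [->|/eqP n1] := eqVneq (yk k) 0; first exact: dot0l.
  have [->|/eqP n2] := eqVneq (yk k') 0; first exact: dot0r.
  have [_ _ _ _ adj] := Omega_intertwines m.
  by apply: (dot_eigen adj (Oyk k) (Oyk k') (rga k')); apply/eqP/gaN.
have yk0 k : (k < b)%N -> yk k = 0.
  move=> kb; apply: (dot_eq0 (hwv_deg (hyk k))); rewrite -/m.
  transitivity (dot m (extract y) (yk k)).
    rewrite extE dot_suml [RHS](bigD1 k) //= big1 ?addr0 // => k' k'k.
    exact: yk_orth.
  rewrite /yk dot_hwprojr //; case: (vP k) => [[->|e] hv]; first by rewrite pre0 dot0r.
  by rewrite /m {1}e psize_addcell -dot_hd hd_extract; apply: orth e hv.
pose u k := hwproj lam (pre b (yk k)).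
have tail_op_pre P x : linear P -> tail_op P (pre b x) = pre b (P x).
  move=> lP; apply: wfP_hd => [|c]; first by rewrite tail_op_nil.
  rewrite hd_tail_op !hd_pre; have P0 : P 0 = 0.
    by have := lP (-1) 0 0; rewrite scaler0 addr0 scaleN1r addNr.
  by have := lP (c == b)%:R x 0; rewrite P0 !addr0.
have uE : tail_op extract z = \sum_k u k.
  have int : intertwines (psize lam) (tail_op extract) (tail_op insert).
    by rewrite lamS; apply: tail_op_intertwines; apply: extract_intertwines.
  rewrite /z -(hwproj_commute _ int) (tail_op_pre _ _ extract_linear) extE.
  by rewrite pre_sum linear_sum.
have Ou k : Omega (u k) = al *: u k by apply: Omega_hwproj.
have Ou' k : tail_op Omega (u k) = ga k *: u k.
  have int : intertwines (psize lam) (tail_op Omega) (tail_op Omega).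
    by rewrite lamS; apply: tail_op_intertwines; apply: Omega_intertwines.
  by rewrite /u -(hwproj_commute _ int) (tail_op_pre _ _ Omega_linear) Oyk preZ linearZ.
have mS : m = m.-1.+1 by rewrite prednK.
have du k : deg m.-1.+2 (u k).
  by rewrite -mS -lamS; apply: hwv_deg; apply: hwproj_hwv.
(* Moving [shf c] to the other side pairs the slice (c, d) with the slice (d, c). *)
have -> : third = dot m.-1.+2 (tail_op extract z) (swap (tail_op extract z)).
  rewrite /third exchange_big dotS; apply: eq_bigr => c _; rewrite dotS; apply: eq_bigr => d _.
  have -> : hd d (hd c (swap (tail_op extract z))) = hd c (hd d (tail_op extract z)) by [].
  by rewrite !hd_tail_op !hd_extract {1}mS dot_sh.
have swap_sum : swap (\sum_k u k) = \sum_k swap (u k).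
  by apply: wfP => -[|c [|d s]]; rewrite /swap !fct_sumE.
rewrite uE swap_sum dot_suml; apply: sumr_ge0 => k _; rewrite dot_sumr; apply: sumr_ge0 => k' _.
have swap0 : swap 0 = 0 by apply: wfP => -[|c [|d s]].
have [e|/eqP nk] := eqVneq (yk k) 0; first by rewrite /u e pre0 linear0 dot0l.
have [e|/eqP nk'] := eqVneq (yk k') 0; first by rewrite /u e pre0 linear0 swap0 dot0r.
apply: (dot_swap (du k) (du k') (Ou k') (Ou' k) (Ou' k')); rewrite ?rga ?rpredB ?rpred_nat //.
(* A cell removed from a row k >= b has smaller content than the cell added to row b. *)
- rewrite gaE //; have [kb|bk|/val_inj ->] := ltngtP k b.
  + by rewrite yk0 in nk.
  + by apply: lt_trans (partition_content pkap bk); rewrite ltrBlDr ltrDl.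
  + by rewrite ltrBlDr ltrDl.
- by have [->|kk'] := eqVneq k k'; [left | right; apply: gaN].
Qed.

Definition is_strip lam mu := forall a b, (a < b)%N -> (lam b <= mu a)%N.

(* Cells are added from the bottom row upwards, so that every intermediate
   shape is a partition exactly when lam / mu is a horizontal strip. *)
Lemma gen_strip_neq0 mu lam x kap : is_partition mu -> is_partition lam -> is_strip lam mu ->
  hwv mu x -> killed x -> x <> 0 ->
  (forall i, mu i <= kap i <= lam i)%N ->
  (forall i j : I, (i < j)%N -> (mu i < kap i)%N -> kap j = lam j) ->
  exists y, [/\ hwv kap y, generated mu x (psize kap) y & y <> 0].
Proof.
move=> pmu plam st hx kx x0; have [r] := ubnP (psize kap).
elim: r kap => // r IH kap; rewrite ltnS => kapr bd bot.
have [[i0 i0P]|noi] := pselect (exists i, (mu i < kap i)%N); last first.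
  have -> : kap = mu.
    apply/ffunP => i; apply/eqP; rewrite eqn_leq; have /andP [-> _] := bd i; rewrite andbT leqNgt.
    by apply/negP => lt; apply: noi; exists i.
  by exists x; split=> //; apply: gen_lowered; apply: lowered_id.
have [b bP bmin] := @arg_minnP _ i0 (fun i => (mu i < kap i)%N) val i0P.
have kap_above (i : I) : (i < b)%N -> kap i = mu i.
  move=> ib; apply/eqP; rewrite eqn_leq; have /andP [-> _] := bd i; rewrite andbT leqNgt.
  by apply/negP => /bmin; rewrite leqNgt ib.
pose kap' := delcell kap b.
have kapE : kap = addcell kap' b.
  apply/ffunP => i; rewrite !ffunE; have [->|_] := eqVneq i b; rewrite /= ?subn0 ?addn0 //.
  by rewrite subnK //; apply: leq_ltn_trans bP.
have kap'E i : i != b -> kap' i = kap i by move=> /negPf ib; rewrite ffunE ib subn0.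
have [||| y [hy gy y0]] := IH kap'.
- by rewrite kapE psize_addcell in kapr.
- move=> i; have [->|ib] := eqVneq i b; last by rewrite kap'E.
  rewrite ffunE eqxx; have := bd b; move: bP; rewrite /=; lia.
- move=> i j ij mi; have bi : (b <= i)%N.
    rewrite leqNgt; apply/negP => ib; move: mi; rewrite kap'E ?kap_above ?ltnn //.
    by apply: contraTneq ib => ->; rewrite ltnn.
  rewrite kap'E; last by apply: contraTneq ij => ->; rewrite -leqNgt.
  by apply: (bot i) => //; apply: leq_trans mi _; rewrite ffunE leq_subr.
have pkap : is_partition kap.
  apply/forallP => i; apply/forallP => j; apply/implyP; rewrite leq_eqVlt => /orP [/eqP/val_inj ->//|ij].
  have [_ kj] := andP (bd j); have [jb|bj] := ltnP j b.
    rewrite !kap_above //; last exact: ltn_trans ij jb.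
    by have /forallP /(_ i) /forallP /(_ j) /implyP := pmu; apply; apply: ltnW.
  apply: leq_trans kj _; apply: leq_trans (st _ _ ij) _; by case/andP: (bd i).
exists (hwproj kap (shf b y)); split.
- exact: hwproj_hwv.
- have wy : wt kap (shf b y) by rewrite kapE; apply: wt_sh; case: hy.
  by apply: gen_hwproj => //; rewrite kapE psize_addcell; apply: gen_sh.
rewrite [in hwproj kap]kapE; apply: hwproj_sh_neq0 => //; first by rewrite -kapE.
move=> k kap'' v kb kap'K hv.
(* Row k < b of [kap'] has mu_k cells, so [kap''] has fewer cells there than mu, and no insertion
   into x has this weight. *)
apply: (@gen_dot0 _ _ mu x (psize kap').-1 (delf k y) _ v _ hv _ _ [::]); last exact: gen_de.
move=> t; apply/eqP; apply: contraT => nz; have e := dot_shs_wt (proj1 hx) (proj1 hv) nz.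
have := kap'E k; rewrite kap'K -e !ffunE eqxx kap_above // => /(_ _) h.
by have : k != b by [apply: contraTneq kb => ->; rewrite ltnn]; move/h; lia.
Qed.

(** If the projection were 0, [gen_dot0] would make the nonzero highest weight vector y of
    [gen_strip_neq0] orthogonal to itself. *)
Lemma hwproj_strip_neq0 mu lam x t : is_partition mu -> is_partition lam -> is_strip lam mu ->
  hwv mu x -> killed x -> x <> 0 -> addcells mu t = lam -> hwproj lam (shs t x) <> 0.
Proof.
move=> pmu plam st hx kx x0 e.
have [||y [hy gy y0]] := @gen_strip_neq0 mu lam x lam pmu plam st hx kx x0.
- by move=> i; rewrite leqnn andbT -e ffunE leq_addr.
- by [].
move=> P0; apply: y0; apply: (dot_eq0 (hwv_deg hy)).
apply: (gen_dot0 hy _ gy [::]) => u; apply/eqP; apply: contraT => nz.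
have eu := dot_shs_wt (proj1 hx) (proj1 hy) nz.
have pe : perm_eq u t.
  apply/allP => i _; have := congr1 (fun k : rowshape N => k i) (etrans eu (esym e)).
  by rewrite !ffunE => /addnI /= ->.
by rewrite (shs_perm _ pe) -dot_hwproj // P0 dot0l eqxx in nz.
Qed.

End Positivity.

(** * Comparison with the operators on tuples *)

Section OperatorsOnWords.
Variables (C : numClosedFieldType) (N : nat).
Local Notation I := 'I_N.
Local Notation F := (seq 'I_N -> C^o).
Local Notation delta := (@delta C N).
Implicit Types (f g h : F) (s t w : seq I) (a b c d k : I) (m n : nat)
  (lam mu kap : rowshape N).

Lemma hd_delta d c w : hd d (delta (c :: w)) = (d == c)%:R *: delta w.
Proof.
apply: wfP => u; rewrite /hd /delta !wfE eqseq_cons.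
by case: (d == c); rewrite ?mul1r ?mul0r.
Qed.

Lemma delta_rev w u : delta (rev w) u = delta w (rev u).
Proof. by rewrite /delta -{1}[u]revK (inj_eq (can_inj revK)). Qed.

Lemma sh_delta a w :
  shf a (delta w) = \sum_(j < (size w).+1) delta (take j w ++ a :: drop j w).
Proof.
elim: w => [|c w IH]; (apply: wfP_hd => [|d]; first by rewrite sh_nil fct_sumE big1 // => j _;
  rewrite /delta; case: (take _ _)).
- rewrite big_ord_recl big_ord0 addr0 /= hd_delta hd_sh.
  have -> : hd d (delta [::]) = 0 by apply: wfP.
  by rewrite shf0 addr0.
- rewrite hd_sum big_ord_recl /= hd_delta hd_sh; congr (_ + _).
  rewrite hd_delta shfZ IH scaler_sumr; apply: eq_bigr => j _.
  by rewrite /= hd_delta.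
Qed.

Lemma de_delta a w :
  delf a (delta w) = \sum_(k < size w | nth a w k == a) delta (take k w ++ drop k.+1 w).
Proof.
elim: w => [|c w IH].
  rewrite big_ord0; apply: wfP => s; apply: de_local => -[|e u] //.
have IH' d : hd d (delf a (delta (c :: w))) =
    (a == c)%:R *: hd d (delta w) + (d == c)%:R *: delf a (delta w).
  by rewrite hd_de !hd_delta hdZ delfZ.
apply: wfP_hd => [|d].
  rewrite de_nil fct_sumE big_mkcond big_ord_recl /= big1 ?addr0 => [|k _]; last first.
    by case: ifP.
  rewrite drop0 hd_app hd_delta wfE /delta eq_sym.
  by case: (c == a); rewrite ?mul1r ?mul0r.
rewrite IH' hd_sum [RHS]big_mkcond big_ord_recl /= drop0 [a == c]eq_sym; congr (_ + _).
  by case: (c == a); rewrite ?scale1r ?scale0r.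
rewrite IH scaler_sumr [LHS]big_mkcond; apply: eq_bigr => k _ /=.
by case: ifP => // _; rewrite hd_delta.
Qed.

Lemma cf_delta m (x : wspace C N m) : cf x = \sum_(w : m.-tuple I) (x w : C) *: delta (rev w).
Proof.
have -> : x = \sum_(w : m.-tuple I) (x w : C) *: wvec C m w.
  apply/ffunP => u; rewrite sum_ffunE (bigD1 u) //= big1 => [|w /negPf wu].
    by rewrite !ffunE eqxx addr0 /GRing.scale /= mulr1.
  by rewrite !ffunE (inj_eq val_inj) eq_sym wu /GRing.scale /= mulr0.
rewrite cf_sum; apply: eq_bigr => w _; rewrite cfZ cf_wvec ?size_tuple //; congr (_ *: _).
rewrite sum_ffunE (bigD1 w) //= big1 => [|u /negPf wu].
  by rewrite !ffunE eqxx addr0 /GRing.scale /= mulr1.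
by rewrite !ffunE (inj_eq val_inj) eq_sym wu /GRing.scale /= mulr0.
Qed.

Lemma sh_rev_delta a w : shf a (delta (rev w)) =
  \sum_(j < (size w).+1) delta (rev (take j w ++ a :: drop j w)).
Proof.
apply: wfP => u; rewrite -[u in LHS]revK rev_sh.
have -> : (fun s => delta (rev w) (rev s)) = delta w.
  by apply: wfP => s; rewrite delta_rev revK.
by rewrite sh_delta !fct_sumE; apply: eq_bigr => j _; rewrite delta_rev.
Qed.

Lemma de_rev_delta a w : delf a (delta (rev w)) =
  \sum_(k < size w | nth a w k == a) delta (rev (take k w ++ drop k.+1 w)).
Proof.
apply: wfP => u; rewrite -[u in LHS]revK rev_de.
have -> : (fun s => delta (rev w) (rev s)) = delta w.
  by apply: wfP => s; rewrite delta_rev revK.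
by rewrite de_delta !fct_sumE; apply: eq_bigr => j _; rewrite delta_rev.
Qed.

Lemma cf_sh a m m' (x : wspace C N m) : m' = m.+1 -> cf (sh C a m m' x) = shf a (cf x).
Proof.
move=> ->; rewrite /sh lfunE /= /wext cf_sum [in RHS]cf_delta shf_sum.
apply: eq_bigr => w _; rewrite cfZ shfZ; congr (_ *: _).
rewrite cf_sum sh_rev_delta size_tuple; apply: eq_bigr => j _.
rewrite cf_wvec // size_cat /= size_take size_drop size_tuple.
by case: ltnP => jm; have := ltn_ord j; lia.
Qed.

Lemma cf_del a m m' (x : wspace C N m) : m = m'.+1 -> cf (del C a m m' x) = delf a (cf x).
Proof.
move=> mm'; rewrite /del lfunE /= /wext cf_sum [in RHS]cf_delta delf_sum.
apply: eq_bigr => w _; rewrite cfZ delfZ; congr (_ *: _).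
rewrite cf_sum de_rev_delta size_tuple; apply: eq_big => [j|j _].
  by rewrite (tnth_nth a).
rewrite cf_wvec // size_cat /= size_take size_drop size_tuple.
by rewrite ltn_ord; have := ltn_ord j; lia.
Qed.

Lemma cf_R2R m (x : wspace C N m) : cf (R2R C N m x) = r2r (cf x).
Proof.
rewrite /R2R sum_lfunE cf_sum; apply: eq_bigr => a _; rewrite comp_lfunE.
case: m x => [|m] x /=; last by rewrite cf_sh // cf_del.
rewrite (deg_de0 a (@cf_deg _ _ _ x)) shf0.
have -> : del C a 0 0 x = 0.
  by rewrite /del lfunE /= /wext big1 // => w _; rewrite big_ord0 scaler0.
by rewrite linear0 cf0.
Qed.

Lemma cf_wcast m m' (x : wspace C N m) : m = m' -> cf (wcast C N m m' x) = cf x.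
Proof.
move=> <-; rewrite /wcast lfunE /= /wext cf_sum [in RHS]cf_delta; apply: eq_bigr => w _.
by rewrite cfZ cf_wvec // size_tuple.
Qed.

Lemma orthoprojP m (U : {vspace wspace C N m}) x :
  orthoproj U x \in U /\ forall u, u \in U -> wdot (x - orthoproj U x) u = 0.
Proof.
rewrite /orthoproj; set V := orthov _ U.
have VP u : (u \in V) <-> (forall p, p \in U -> wdot u p = 0).
  by split=> [/mem_orthovP uV p pU|uV]; [apply: uV | apply/mem_orthovP => p; apply: uV].
have UV : (U :&: V = 0)%VS.
  apply/eqP; rewrite -subv0; apply/subvP => u; rewrite memv_cap memv0 => /andP [uU /VP /(_ u uU)].
  rewrite wdotE => /(dot_eq0 (@cf_deg _ _ _ u)) e; apply/eqP; apply: cf_inj.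
  by rewrite e cf0.
split; first exact: memv_pi.
have [p pU pP] := orthogonal_split U x.
have xUV : (x \in U + V)%VS.
  by rewrite -[x](subrK p) addrC memv_add //; apply/VP.
apply/VP; rewrite -{1}(daddv_pi_add UV xUV) addrC addKr.
exact: memv_pi.
Qed.

Lemma cf_orthoproj lam x : is_partition lam ->
  cf (orthoproj (Specht C lam) x) = hwproj lam (cf x).
Proof.
move=> plam; have [pU pP] := orthoprojP (Specht C lam) x.
apply/esym/hwproj_unique => [|h hh]; first exact/(spechtP plam).
have hE : cf (mk (psize lam) h) = h by apply: mkK; apply: hwv_deg.
have /pP : mk (psize lam) h \in Specht C lam by apply/(spechtP plam); rewrite hE.
by rewrite wdotE hE cfD cfN dotDl dotNl => /eqP; rewrite subr_eq0 => /eqP.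
Qed.

Lemma cf_lift_op kap (r : I) y : is_partition (addcell kap r) ->
  cf (lift_op C kap r y) = hwproj (addcell kap r) (shf r (cf y)).
Proof. by move=> pk; rewrite /lift_op comp_lfunE cf_orthoproj // cf_sh // psize_addcell. Qed.

Lemma cf_lift_seq kap (rs : seq I) m y : m = (size rs + psize kap)%N ->
  (forall j, is_partition (addcells kap (take j rs))) ->
  cf (lift_seq C kap rs m y) = lifts kap rs (cf y).
Proof.
elim: rs kap y => [|r rs IH] kap y; first by move=> -> _; rewrite /= cf_wcast.
move=> mE prs; have pr : is_partition (addcell kap r).
  by have := prs 1%N; rewrite /= take0 addcells_cons addcells_nil.
rewrite /= comp_lfunE IH ?cf_lift_op //; first by rewrite psize_addcell mE /= addnS.
by move=> j; have := prs j.+1; rewrite /= addcells_cons.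
Qed.

Lemma psize_addcells mu t : psize (addcells mu t) = (size t + psize mu)%N.
Proof.
elim: t mu => [|a t IH] mu; first by rewrite addcells_nil.
by rewrite addcells_cons IH psize_addcell /= addnS.
Qed.

Lemma strip_rows_sorted lam mu : sorted leq [seq val r | r <- strip_rows lam mu].
Proof.
rewrite sorted_pairwise; last exact: leq_trans.
rewrite pairwise_map /strip_rows.
have : pairwise (relpre val ltn) (enum 'I_N).
  by rewrite -pairwise_map val_enum_ord -sorted_pairwise ?iota_ltn_sorted //; apply: ltn_trans.
elim: (enum 'I_N) => //= i s IH /andP [/allP si /IH ps].
rewrite pairwise_cat ps andbT; apply/andP; split.
  apply/allrelP => a b; rewrite mem_nseq => /andP [_ /eqP ->].
  move=> /flatten_mapP [j js]; rewrite mem_nseq => /andP [_ /eqP ->].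
  by have := si j js; rewrite /= => /ltnW.
by elim: (_ - _)%N => //= k' ->; rewrite andbT; apply/allP => a; rewrite mem_nseq => /andP [_ /eqP ->] /=.
Qed.

Lemma strip_rows_cells lam mu : (forall i, mu i <= lam i)%N ->
  addcells mu (strip_rows lam mu) = lam.
Proof.
move=> ml; apply/ffunP => i; rewrite ffunE /strip_rows count_flatten -map_comp sumnE big_map.
rewrite big_enum /= (bigD1 i) //= big1 => [|j /negPf ji].
  by rewrite count_nseq /= eqxx mul1n addn0 subnKC.
by rewrite count_nseq /= ji mul0n.
Qed.

(** For rows a < b: while row a is incomplete, row b is still that of mu; afterwards row a is that
    of lam. *)
Lemma strip_rows_partition lam mu j : is_partition lam -> is_partition mu ->
  (forall i, mu i <= lam i)%N -> is_partition (addcells mu (take j (strip_rows lam mu))).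
Proof.
move=> plam pmu ml; set rs := strip_rows lam mu.
have cells := strip_rows_cells ml; have := strip_rows_sorted lam mu; rewrite -/rs in cells *.
rewrite sorted_pairwise; last exact: leq_trans.
rewrite pairwise_map -{1}(cat_take_drop j rs) pairwise_cat => /andP [/allrelP le_td _].
apply/forallP => a; apply/forallP => b; apply/implyP; rewrite leq_eqVlt => /orP [/eqP/val_inj ->//|ab].
have cnt i : lam i = (addcells mu (take j rs) i + count_mem i (drop j rs))%N.
  by rewrite -cells !ffunE -{1}(cat_take_drop j rs) count_cat addnA.
have [ad|ad] := boolP (a \in drop j rs).
  rewrite !ffunE (count_memPn _) ?addn0.
    apply: leq_trans (leq_addr _ _).
    by have /forallP /(_ a) /forallP /(_ b) /implyP := pmu; apply; apply: ltnW.
  by apply/negP => /le_td /(_ ad) /=; rewrite leqNgt ab.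
have := cnt a; rewrite (count_memPn ad) addn0 => <-.
apply: (@leq_trans (lam b)); first by rewrite cnt leq_addr.
by have /forallP /(_ a) /forallP /(_ b) /implyP := plam; apply; apply: ltnW.
Qed.

Lemma hstripP lam mu : is_partition lam -> hstrip lam mu <->
  [/\ is_partition mu, forall i, (mu i <= lam i)%N & is_strip lam mu].
Proof.
move=> plam; split=> [/and3P [pmu /forallP ml /forallP st]|[pmu ml st]].
  split=> // a b ab; rewrite leqNgt; apply/negP => lt.
  have lab : (lam b <= lam a)%N.
    by have /forallP /(_ a) /forallP /(_ b) /implyP := plam; apply; apply: ltnW.
  have mba : (mu b <= mu a)%N.
    by have /forallP /(_ a) /forallP /(_ b) /implyP := pmu; apply; apply: ltnW.
  have js : (mu a < psize lam)%N.
    by apply: leq_trans lt _; rewrite /psize (bigD1 b) //= leq_addr.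
  (* Column mu_a would meet the strip in both rows a and b. *)
  have := st (Ordinal js); apply/negP; rewrite -ltnNge; apply/card_gt1P; exists a, b.
  rewrite !inE /= leqnn mba lt /=; split=> //; first exact: leq_trans lt lab.
  by apply: contraTneq ab => ->; rewrite ltnn.
apply/and3P; split=> //; first exact/forallP.
apply/forallP => j; rewrite leqNgt; apply/negP => /card_gt1P [a [b]].
rewrite !inE => -[/andP [ma la] /andP [mb lb]].
have [ab|ba|/val_inj ->] := ltngtP a b; last by rewrite eqxx.
  by move=> _; have := leq_trans (st a b ab) ma; rewrite leqNgt lb.
by move=> _; have := leq_trans (st b a ba) mb; rewrite leqNgt la.
Qed.

Lemma strip_row_sum (i p q : nat) : (p <= q)%N ->
  \sum_(k < q | (p <= k)%N) (k%:Z - i%:Z) =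
    ('C(q, 2)%:Z - (i * q)%N%:Z) - ('C(p, 2)%:Z - (i * p)%N%:Z).
Proof.
elim: q => [|q IH]; first by rewrite leqn0 => /eqP ->; rewrite big_ord0 subrr.
rewrite leq_eqVlt => /orP [/eqP ->|].
  by rewrite subrr big1 // => k; rewrite leqNgt ltn_ord.
rewrite ltnS => pq; rewrite big_mkcond big_ord_recr /= -big_mkcond pq IH //.
by rewrite binS bin1 mulnS !PoszD; ring.
Qed.

Lemma eig_content lam mu : (forall i, mu i <= lam i)%N ->
  eig lam mu = content_weight lam - content_weight mu.
Proof.
move=> ml; rewrite /eig /content_weight.
have -> : \sum_(c : cell lam | (mu (crow c) <= ccol c)%N) ((ccol c)%:Z - (crow c)%:Z) =
    \sum_i \sum_(k < lam i | (mu i <= k)%N) (k%:Z - i%:Z).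
  by rewrite (sig_big_dep xpredT (fun i (k : 'I_(lam i)) => (mu i <= k)%N)
    (fun i (k : 'I_(lam i)) => k%:Z - i%:Z)).
rewrite (eq_bigr _ (fun (i : I) _ => strip_row_sum i (ml i))) sumrB; ring.
Qed.

End OperatorsOnWords.

(** * The decomposition *)

Section Decomposition.
Variables (C : numClosedFieldType) (N : nat) (lam : rowshape N).
Hypothesis plam : is_partition lam.
Local Notation I := 'I_N.
Local Notation F := (seq 'I_N -> C^o).
Local Notation n := (psize lam).
Local Notation T := (wspace C N n).
Implicit Types (mu : rowshape N).

Lemma cf_lift_skew mu x : hstrip lam mu -> hwv mu (cf x) ->
  cf (lift_skew C lam mu x) = hwproj lam (shs (strip_rows lam mu) (cf x)).
Proof.
move=> /(hstripP _ plam) [pmu ml st] hx; have cells := strip_rows_cells ml.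
rewrite /lift_skew cf_lift_seq.
- by apply: lifts_hwproj => //; apply: strip_rows_sorted.
- by rewrite -psize_addcells cells.
- by move=> j; apply: strip_rows_partition.
Qed.

Lemma kerR2RP mu x : is_partition mu ->
  x \in kerR2R C mu <-> hwv mu (cf x) /\ killed (cf x).
Proof.
move=> pmu; rewrite /kerR2R memv_cap memv_ker; split=> [/andP [/(spechtP pmu) hx /eqP Rx]|[hx kx]].
  split=> //; apply: (r2r_eq0 (hwv_deg hx)).
  by rewrite -cf_R2R Rx cf0.
apply/andP; split; first exact/(spechtP pmu).
by apply/eqP; apply: cf_inj; rewrite cf_R2R cf0 killed_r2r.
Qed.

Lemma lift_skew_ker mu x : hstrip lam mu -> x \in kerR2R C mu ->
  [/\ hwv lam (cf (lift_skew C lam mu x)),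
      generated mu (cf x) n (cf (lift_skew C lam mu x)),
      R2R C N n (lift_skew C lam mu x) = (eig lam mu)%:~R *: lift_skew C lam mu x
    & lift_skew C lam mu x = 0 -> x = 0].
Proof.
move=> hs; have [pmu ml st] := (hstripP mu plam).1 hs; move=> /(kerR2RP _ pmu) [hx kx].
have cells := strip_rows_cells ml; rewrite (cf_lift_skew hs hx).
set rs := strip_rows lam mu in cells *; split.
- exact: hwproj_hwv.
- apply: gen_hwproj => //; first by rewrite -{1}cells; apply: wt_shs; case: hx.
  by rewrite -{1}cells psize_addcells; apply: gen_shs.
- apply: cf_inj; rewrite cf_R2R cfZ (cf_lift_skew hs hx) -/rs.
  have liftE := lifts_hwproj (strip_rows_sorted lam mu) hx cells.
  by have := r2r_lifts rs hx kx; rewrite cells liftE eig_content.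
- move=> l0; apply: cf_inj; rewrite cf0; apply: contrapT => x0.
  apply: (hwproj_strip_neq0 pmu plam st hx kx x0 cells).
  by rewrite -/rs -(cf_lift_skew hs hx) l0 cf0.
Qed.

Local Notation lifted mu := (lift_skew C lam mu @: kerR2R C mu)%VS.

Lemma subshape_val_inj : injective (@subshape_val N lam).
Proof.
move=> mu mu' /ffunP e; apply/ffunP => i; apply: val_inj.
by have := e i; rewrite !ffunE.
Qed.

Lemma lifted_orth (mu mu' : subshape lam) u v : hstrip lam mu -> hstrip lam mu' -> mu != mu' ->
  u \in lifted mu -> v \in lifted mu' -> wdot u v = 0.
Proof.
move=> hs hs' mumu' /memv_imgP [x kx ->] /memv_imgP [y ky ->]; rewrite wdotE.
have [_ gx _ _] := lift_skew_ker hs kx; have [_ gy _ _] := lift_skew_ker hs' ky.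
have [pmu _ _] := (hstripP mu plam).1 hs; have [pmu' _ _] := (hstripP mu' plam).1 hs'.
have [hx kx'] := (kerR2RP x pmu).1 kx; have [hy ky'] := (kerR2RP y pmu').1 ky.
apply: (gen_orth hx hy kx' ky' _ gx gy).
by move=> /subshape_val_inj e; rewrite e eqxx in mumu'.
Qed.

Lemma lifted_direct (P : pred (subshape lam)) : (forall mu : subshape lam, P mu -> hstrip lam mu) ->
  directv (\sum_(mu : subshape lam | P mu) lifted mu).
Proof.
move=> Ph; apply/directv_sum_independent => us Us us0 mu Pmu.
apply: cf_inj; rewrite cf0; apply: (dot_eq0 (@cf_deg _ _ _ _)); rewrite -wdotE.
have : wdot (\sum_(mu | P mu) us mu) (us mu) = 0 by rewrite us0 wdotE cf0 dot0l.
rewrite wdotE cf_sum dot_suml (bigD1 mu) //= big1 ?addr0 -?wdotE // => mu' /andP [Pmu' ne].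
by rewrite -wdotE; apply: (lifted_orth (Ph _ Pmu') (Ph _ Pmu) ne); apply: Us.
Qed.

Lemma lifted_eigen mu u : hstrip lam mu -> u \in lifted mu ->
  u \in Specht C lam /\ R2R C N n u = (eig lam mu)%:~R *: u.
Proof.
move=> hs /memv_imgP [x kx ->]; have [hx _ Rx _] := lift_skew_ker hs kx.
by split=> //; apply/(spechtP plam).
Qed.

Lemma lifted_span : Specht C lam = (\sum_(mu : subshape lam | hstrip lam mu) lifted mu)%VS.
Proof.
apply/eqP; rewrite eqEsubv; apply/andP; split; last first.
  by apply/subv_sumP => mu hs; apply/subvP => u /(lifted_eigen hs) [].
set U := (\sum_(mu | _) _)%VS; apply/subvP => x /(spechtP plam) hx.
have [p pU pP] := orthogonal_split U x.
have hp : hwv lam (cf p).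
  apply/(spechtP plam); apply: subvP pU; apply/subv_sumP => mu hs.
  by apply/subvP => u /(lifted_eigen hs) [].
suff q0 : cf (x - p) = 0.
  have /eqP : x - p = 0 by apply: cf_inj; rewrite q0 cf0.
  by rewrite subr_eq0 => /eqP ->.
have hq : hwv lam (cf (x - p)) by rewrite cfD cfN; apply: hwvB.
(* A nonzero remainder would pair nontrivially with the lift of some y in a kernel, and this lift
   lies in U. *)
apply: contrapT => /(hwv_reach hq) [mu [y [t [hy ky nz]]]].
have cells := dot_shs_wt (proj1 hy) (proj1 hq) nz.
have pmu : is_partition mu.
  by apply: (hwv_partition hy) => y0; move: nz; rewrite y0 shs0 dot0l eqxx.
have ml i : (mu i <= lam i)%N by rewrite -cells ffunE leq_addr.
have hs : hstrip lam mu.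
  apply/(hstripP _ plam); split=> // a b ab; rewrite leqNgt; apply/negP => lt.
  move: nz; rewrite (dot_shs_nonstrip _ ab _ hy hq cells) ?eqxx // lt andbT.
  by have /forallP /(_ a) /forallP /(_ b) /implyP := pmu; apply; apply: ltnW.
pose mu' : subshape lam := [ffun i => inord (mu i)].
have muE : mu = mu' by apply/ffunP => i; rewrite !ffunE inordK // ltnS.
have yE : cf (mk (psize mu) y) = y by apply: mkK; apply: hwv_deg.
have yk : mk (psize mu) y \in kerR2R C mu by apply/(kerR2RP _ pmu); rewrite yE.
(* The types of the kernel and of the lift depend on the shape, so the equality of mu and [mu'] is
   used through a variable nu. *)
have subU (nu : rowshape N) : nu = mu' -> hstrip lam nu -> (lifted nu <= U)%VS.
  by move=> -> hnu; apply: (sumv_sup mu').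
have lU := subvP (subU _ muE hs) _ (memv_img (lift_skew C lam mu) yk).
have := pP _ lU; rewrite wdotE => /dot_eq0C.
rewrite cf_lift_skew ?yE // dot_hwproj // (@shs_perm _ _ _ t) => [e|]; first by rewrite e eqxx in nz.
apply/allP => i _; apply/eqP.
have := congr1 (fun k : rowshape N => k i) (etrans (strip_rows_cells ml) (esym cells)).
by rewrite !ffunE => /addnI.
Qed.

Lemma eigenspace_lifted (e : C) : eigenR2R lam e =
  (\sum_(mu : subshape lam | hstrip lam mu && ((eig lam mu)%:~R == e)) lifted mu)%VS.
Proof.
have eigP x : (x \in eigenR2R lam e) = (x \in Specht C lam) && (R2R C N n x == e *: x).
  rewrite /eigenR2R memv_cap; congr andb; rewrite memv_ker.
  by rewrite add_lfunE opp_lfunE scale_lfunE id_lfunE subr_eq0.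
apply/eqP; rewrite eqEsubv; apply/andP; split; last first.
  apply/subv_sumP => mu /andP [hs /eqP ee]; apply/subvP => u /(lifted_eigen hs) [uS Ru].
  by rewrite eigP uS Ru ee eqxx.
apply/subvP => x; rewrite eigP lifted_span => /andP [/memv_sumP [us Us xE] Rx].
have dir := lifted_direct (P := fun mu : subshape lam => hstrip lam mu) (fun _ hs => hs).
(* These are the components of R2R x - e x = 0; directness makes each of them 0. *)
have zero : \sum_(mu : subshape lam | hstrip lam mu) ((eig lam mu)%:~R - e) *: us mu = 0.
  rewrite (eq_bigr (fun mu : subshape lam => R2R C N n (us mu) - e *: us mu)).
    rewrite sumrB -scaler_sumr -xE -(eqP Rx); apply/eqP; rewrite subr_eq0; apply/eqP.
    by rewrite [in RHS]xE linear_sum.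
  by move=> mu hs; rewrite (lifted_eigen hs (Us _ hs)).2 scalerBl.
have us0 := directv_sum_independent dir _ _ zero.
have {}us0 (mu : subshape lam) : hstrip lam mu -> ((eig lam mu)%:~R - e) *: us mu = 0.
  by apply: us0 => nu hnu; apply: memvZ; apply: Us.
rewrite xE (bigID (fun mu : subshape lam => (eig lam mu)%:~R == e)) /= [X in _ + X]big1 ?addr0.
  by apply: memv_sumr => mu /andP [hs _]; apply: Us.
move=> mu /andP [hs ne]; have /eqP := us0 mu hs; rewrite scaler_eq0 subr_eq0 (negPf ne) /=.
by move=> /eqP.
Qed.

Lemma lifted_eigenbasis (K : forall mu, seq (wspace C N (psize mu))) :
  (forall mu, hstrip lam mu -> basis_of (kerR2R C mu) (K mu)) ->
  is_eigenbasis (\big[cat/[::]]_(mu : subshape lam | hstrip lam mu)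
    [seq lift_skew C lam mu v | v <- K mu]).
Proof.
move=> KB; set X := \big[_/_]_(mu | _) _.
have XB : basis_of (Specht C lam) X.
  rewrite lifted_span; apply: bigcat_basis; first exact: lifted_direct.
  move=> mu hs; apply: limg_basis_of (KB _ hs).
  (* The lift is injective on the kernel, so it carries a basis to a basis. *)
  apply/eqP; rewrite -subv0; apply/subvP => x; rewrite memv_cap memv0 memv_ker.
  move=> /andP [kx /eqP lx]; have [_ _ _ inj] := lift_skew_ker hs kx.
  by apply/eqP; apply: inj.
split=> // v vX; split; first exact: free_not0 (basis_free XB) vX.
have [mu hs vmu] : exists2 mu : subshape lam, hstrip lam mu &
    v \in [seq lift_skew C lam mu w | w <- K mu].
  elim/big_rec: X vX {XB} => // mu Y hs IH; rewrite mem_cat => /orP [vY|/IH //].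
  by exists mu.
exists (eig lam mu)%:~R; case/mapP: vmu => w wK ->.
by have [] := lift_skew_ker hs (basis_mem (KB _ hs) wK).
Qed.

End Decomposition.

Theorem theorem26 (R : realType) (N : nat) (lam : rowshape N) :
  is_partition lam ->
  [/\ directv (\sum_(mu : subshape lam | hstrip lam mu)
                 lift_skew R[i] lam mu @: kerR2R R[i] mu)
      /\ Specht R[i] lam
           = (\sum_(mu : subshape lam | hstrip lam mu)
                 lift_skew R[i] lam mu @: kerR2R R[i] mu)%VS,
      forall e : R[i],
        directv (\sum_(mu : subshape lam |
                         hstrip lam mu && ((eig lam mu)%:~R == e))
                   lift_skew R[i] lam mu @: kerR2R R[i] mu)
        /\ eigenR2R lam e
             = (\sum_(mu : subshape lam |
                         hstrip lam mu && ((eig lam mu)%:~R == e))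
                   lift_skew R[i] lam mu @: kerR2R R[i] mu)%VS
    & forall K : forall mu : rowshape N, seq (wspace R[i] N (psize mu)),
        (forall mu : rowshape N, hstrip lam mu -> basis_of (kerR2R R[i] mu) (K mu)) ->
        is_eigenbasis
          (\big[cat/[::]]_(mu : subshape lam | hstrip lam mu)
              [seq lift_skew R[i] lam mu v | v <- K mu])].
Proof.
move=> plam; split.
- by split; [apply: lifted_direct | apply: lifted_span].
- by move=> e; split; [apply: lifted_direct => // mu /andP [] | apply: eigenspace_lifted].
- by move=> K; apply: lifted_eigenbasis.
Qed.
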